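(* Let $X$ and $Y$ be compact subsets of $\mathbb{R}^n$ and let $c: X\times Y\to\mathbb{R}$ be a measurable cost function which is twice differentiable in the sense that the mixed Hessians $D^2_{xy}c$ and $D^2_{yx}c$ exist and $(D^2_{xy}c)^T = D^2_{yx}c$. Assume that $c$ satisfies: (Twisted) $-D_x c(x,\cdot): Y\to T^*_xX$ is injective for every $x\in X$; (Twisted* ) $-D_y c(\cdot,y): X\to T^*_yY$ is injective for every $y\in Y$; (Non-degenerate) $D^2_{xy}c(x,y)$ is invertible for every $(x,y)\in X\times Y$; (Lip hessian) $D^2_{xy}c$ is Lipschitz on $X\times Y$; ($c$DomConv) $Y^*_x:=-D_xc(x,Y)$ is convex for every $x\in X$; ($c$DomConv* ) $X^*_y:=-D_yc(X,y)$ is convex for every $y\in Y$. If $c$ satisfies Loeper's condition, then $c$ is quantitatively quasi-convex (QQconv).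
   Context: For $x\in X$, the $c$-exponential map $\exp^c_x: Y^*_x\to Y$ is the inverse of $-D_xc(x,\cdot)$, i.e. $-D_xc(x,\exp^c_x(p))=p$. For $x_0\in X$, $v_0,v_1\in Y^*_{x_0}$, $t\in[0,1]$, set $v_t=(1-t)v_0+tv_1$ and $f_t(x)=-c(x,\exp^c_{x_0}(v_t))+c(x_0,\exp^c_{x_0}(v_t))$. Loeper's condition: $f_t(x)\le\max\{f_1(x),f_0(x)\}$ for all $x,x_0\in X$, all $v_0,v_1\in Y^*_{x_0}$ and all $t\in[0,1]$. QQconv: there exists a constant $M\ge 1$ such that $f_t(x)-f_0(x)\le Mt\,(f_1(x)-f_0(x))_+$ for all $x,x_0\in X$, all $v_0,v_1\in Y^*_{x_0}$ and all $t\in[0,1]$, where $a_+=\max\{a,0\}$. *)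

(* Defs.v *)
From HB Require Import structures.
From mathcomp Require Import all_boot all_order all_algebra.
From mathcomp Require Import all_classical all_reals all_analysis.
Set Implicit Arguments. Unset Strict Implicit. Unset Printing Implicit Defensive.
Import Order.TTheory GRing.Theory Num.Theory.
Import numFieldNormedType.Exports.
Local Open Scope classical_set_scope.
Local Open Scope ring_scope.

Section CostDefs.
Variables (R : realType) (n : nat).
Local Notation V := 'rV[R]_n.
Implicit Types (c : V -> V -> R) (x y : V) (X Y : set V).

Definition ebase (i : 'I_n) : V := delta_mx 0 i.

Definition Dx c x y : V := \row_i 'D_(ebase i) (fun x' => c x' y) x.
Definition Dy c x y : V := \row_j 'D_(ebase j) (fun y' => c x y') y.
Definition D2xy c x y : 'M[R]_n :=
  \matrix_(i, j) 'D_(ebase j) (fun y' => Dx c x y' 0 i) y.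
Definition D2yx c x y : 'M[R]_n :=
  \matrix_(j, i) 'D_(ebase i) (fun x' => Dy c x' y 0 j) x.

Definition Ystar c Y x : set V := (fun y => - Dx c x y) @` Y.
Definition Xstar c X y : set V := (fun x => - Dy c x y) @` X.

Definition convex_set_of (S : set V) : Prop :=
  forall a b, S a -> S b -> forall t : R, 0 <= t <= 1 ->
    S ((1 - t) *: a + t *: b).

(* c-exponential map: exp^c_x(p) is the (unique under Twisted) y in Y
   with -D_x c(x,y) = p *)
Definition cexp c Y x (p : V) : V := xget 0 [set y | Y y /\ - Dx c x y = p].

Definition ft c Y x0 (v0 v1 : V) (t : R) (x : V) : R :=
  let vt := (1 - t) *: v0 + t *: v1 in
  - c x (cexp c Y x0 vt) + c x0 (cexp c Y x0 vt).

Definition Loeper c X Y : Prop :=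
  forall x x0, X x -> X x0 -> forall v0 v1, Ystar c Y x0 v0 -> Ystar c Y x0 v1 ->
  forall t : R, 0 <= t <= 1 ->
    ft c Y x0 v0 v1 t x <= Num.max (ft c Y x0 v0 v1 1 x) (ft c Y x0 v0 v1 0 x).

Definition QQconv c X Y : Prop :=
  exists M : R, 1 <= M /\
  forall x x0, X x -> X x0 -> forall v0 v1, Ystar c Y x0 v0 -> Ystar c Y x0 v1 ->
  forall t : R, 0 <= t <= 1 ->
    ft c Y x0 v0 v1 t x - ft c Y x0 v0 v1 0 x
      <= M * t * Num.max (ft c Y x0 v0 v1 1 x - ft c Y x0 v0 v1 0 x) 0.

End CostDefs.

(* Main.v *)
Require Import Defs.
From HB Require Import structures.
From mathcomp Require Import all_boot all_order all_algebra.
From mathcomp Require Import all_classical all_reals all_analysis.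
From mathcomp Require Import ring lra.
Import Order.TTheory GRing.Theory Num.Theory.
Import numFieldNormedType.Exports.
Local Open Scope classical_set_scope.
Local Open Scope ring_scope.
Set Implicit Arguments. Unset Strict Implicit. Unset Printing Implicit Defensive.

(** Write [p = - D_x c], [q = - D_y c], [A = - D2_xy c], and
    [H x = - c x y1 + c x y0] for fixed [y0], [y1].  Let [s] be the derivative of
    [H] at [x0], in the coordinates [q(., y0)], towards [x].  The key estimate is
    [H x - H x0 >= k s] when [s > 0], with [k] uniform.  Since [s] is also the
    initial speed of [t |-> f_t x], applying it to the piece of the c-segment
    after a time [u < t] with [f_u' x >= (f_t x - f_0 x) / t] gives QQconv for
    [t < 1/2]; for [t >= 1/2] Loeper's condition suffices.

    Loeper's condition at a base point says that [H] increases along every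
    c*-segment on which its initial derivative is positive.  At a relative interior
    point it follows that [H] does not decrease in directions annihilated by its
    derivative, and comparing a direction [e] with such a direction gives
    [H (x + e) >= H x + H'(x) e - K |e| |H'(x) e|] in these coordinates.  Using
    this inequality both forwards and backwards, the derivative of [H] along a
    c*-segment decreases at most exponentially, at a rate that does not depend on
    the distance to the boundary; endpoints on the boundary are reached by
    continuity.  The sets [q(X, y)] may have empty interior, so everything is
    relative to their linear spans, which are carried to each other by [A]. *)

(** * One-sided differentiation on the unit interval *)

Section UnitDeriv.
Context {R : realType}.

(** Frechet differentiability at [x] in epsilon-delta form. Linearity and boundedness of [L] are
    separate hypotheses of the lemmas that use them. *)
Definition approx_lin {V W : normedModType R} (f : V -> W) (x : V) (L : V -> W) :=
  forall e : R, 0 < e -> exists2 d : R, 0 < d &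
    forall y, `|y - x| < d -> `|f y - f x - L (y - x)| <= e * `|y - x|.

(* Derivative at [t] along the unit interval only, hence one-sided at 0 and 1. *)
Definition unit_deriv {V : normedModType R} (f : R -> V) (t : R) (l : V) :=
  forall e : R, 0 < e -> exists2 d : R, 0 < d &
    forall s, 0 <= s <= 1 -> `|s - t| < d ->
      `|f s - f t - (s - t) *: l| <= e * `|s - t|.

Lemma differentiable_approx {V W : normedModType R} (f : V -> W) x :
  differentiable f x -> approx_lin f x ('d f x).
Proof.
move=> /diff_locally /eqaddoP H e e0.
have /nbhs_ballP [d /= d0 Hd] := H _ e0.
exists d => // y yx.
have := Hd (y - x); rewrite -ball_normE /= sub0r normrN => /(_ yx).
rewrite /= !fctE /= /shift /= subrK opprD addrA.
by [].
Qed.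

Lemma unit_deriv_comp {V W : normedModType R} (f : V -> W) (g : R -> V) t
    (L : V -> W) l (C : R) :
  (forall u k v, L (u - k *: v) = L u - k *: L v) ->
  approx_lin f (g t) L -> (forall h, `|L h| <= C * `|h|) ->
  unit_deriv g t l -> unit_deriv (f \o g) t (L l).
Proof.
move=> Llin fL LC gl e e0.
have C0 : 0 < `|C| + 1 by rewrite ltr_wpDl.
have LC' h : `|L h| <= (`|C| + 1) * `|h|.
  apply: (le_trans (LC h)); rewrite ler_wpM2r //.
  by rewrite (le_trans (ler_norm _)) // lerDl.
have l0 : 0 < `|l| + 1 by rewrite ltr_wpDl.
have [d1 d10 H1] := fL (e / 2 / (`|l| + 1)) ltac:(by rewrite !divr_gt0).
set e2 := Num.min 1 (e / 2 / (`|C| + 1)).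
have e20 : 0 < e2 by rewrite lt_min ltr01 !divr_gt0.
have [d2 d20 H2] := gl _ e20.
exists (Num.min d2 (d1 / (`|l| + 1))); first by rewrite lt_min d20 divr_gt0.
move=> s s01; rewrite lt_min => /andP [sd2 sd1].
have {H2 sd2}H2 := H2 s s01 sd2.
have gs : `|g s - g t| <= (`|l| + 1) * `|s - t|.
  rewrite -[g s - g t](subrK ((s - t) *: l)) (le_trans (ler_normD _ _)) //.
  rewrite normrZ mulrDl addrC [`|l| * _]mulrC lerD2l (le_trans H2) //.
  by rewrite ler_wpM2r // ge_min lexx.
have gsd : `|g s - g t| < d1.
  by rewrite (le_lt_trans gs) // mulrC -ltr_pdivlMr.
have {H1 gsd}H1 := H1 _ gsd.
have -> : (f \o g) s - (f \o g) t - (s - t) *: L l =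
    (f (g s) - f (g t) - L (g s - g t)) + L (g s - g t - (s - t) *: l).
  by rewrite Llin [RHS]addrA subrK.
rewrite (le_trans (ler_normD _ _)) // [e]splitr mulrDl lerD //.
  apply: (le_trans H1); apply: (le_trans (ler_wpM2l _ gs)).
    by rewrite ltW // !divr_gt0.
  by rewrite mulrA divfK ?lexx // gt_eqF.
apply: (le_trans (LC' _)); apply: (le_trans (ler_wpM2l _ H2)); first exact: ltW.
rewrite mulrA ler_wpM2r // mulrC -ler_pdivlMr // ge_min.
by rewrite lexx orbT.
Qed.

Lemma unit_deriv_cont {V : normedModType R} (f : R -> V) t l :
  unit_deriv f t l -> forall e : R, 0 < e -> exists2 d : R, 0 < d &
    forall s, 0 <= s <= 1 -> `|s - t| < d -> `|f s - f t| < e.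
Proof.
move=> fl e e0; have [d d0 H] := fl 1 ltr01.
have l0 : 0 < 1 + `|l| by rewrite ltr_wpDr.
exists (Num.min d (e / (1 + `|l|))); first by rewrite lt_min d0 divr_gt0.
move=> s s01; rewrite lt_min => /andP [sd se].
rewrite -[f s - f t](subrK ((s - t) *: l)) (le_lt_trans (ler_normD _ _)) //.
rewrite (le_lt_trans (lerD (H s s01 sd) (lexx _))) // normrZ.
by rewrite [_ * `|l|]mulrC -mulrDl mulrC -ltr_pdivlMr.
Qed.

Lemma unit_derivD {V : normedModType R} (f g : R -> V) t l m :
  unit_deriv f t l -> unit_deriv g t m -> unit_deriv (fun s => f s + g s) t (l + m).
Proof.
move=> fl gm e e0; have e20 : 0 < e / 2 by rewrite divr_gt0.
have [d1 d10 H1] := fl _ e20; have [d2 d20 H2] := gm _ e20.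
exists (Num.min d1 d2); first by rewrite lt_min d10.
move=> s s01; rewrite lt_min => /andP [sd1 sd2].
have -> : f s + g s - (f t + g t) - (s - t) *: (l + m) =
   (f s - f t - (s - t) *: l) + (g s - g t - (s - t) *: m).
  by rewrite scalerDr !opprD [f s + g s + _]addrACA [LHS]addrACA.
by rewrite (le_trans (ler_normD _ _)) // [e]splitr mulrDl lerD // ?H1 ?H2.
Qed.

Lemma unit_derivZ {V : normedModType R} (k : R) (f : R -> V) t l :
  unit_deriv f t l -> unit_deriv (fun s => k *: f s) t (k *: l).
Proof.
move=> fl e e0.
have k0 : 0 < `|k| + 1 by rewrite ltr_wpDl.
have [d d0 H] := fl (e / (`|k| + 1)) ltac:(by rewrite divr_gt0).
exists d => // s s01 sd.
rewrite scalerA [(s - t) * k]mulrC -scalerA -!scalerBr normrZ.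
rewrite (le_trans (ler_wpM2l _ (H s s01 sd))) // mulrA ler_wpM2r //.
rewrite mulrA ler_pdivrMr // [`|k| * e]mulrC ler_wpM2l ?ltW //.
by rewrite ltrDl.
Qed.

(** Inside the interval the derivative is two-sided, and at the ends [unit_deriv] still gives
    one-sided continuity, so the mean value theorem applies. *)
Lemma unit_mvt (f df : R -> R) :
  (forall t, 0 <= t <= 1 -> unit_deriv (V := R^o) f t (df t)) ->
  forall a b, 0 <= a -> a < b -> b <= 1 ->
  exists2 c, a < c < b & f b - f a = df c * (b - a).
Proof.
move=> H a b a0 ab b1.
have sub01 x : a <= x <= b -> 0 <= x <= 1.
  by move=> /andP [ax xb]; rewrite (le_trans a0 ax) (le_trans xb b1).
have [||c] := @MVT R f df a b ab.
- move=> x; rewrite in_itv /= => /andP [ax xb].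
  have x01 : 0 <= x <= 1 by apply: sub01; rewrite !ltW.
  have cvx : (fun h : R => h^-1 *: ((f \o shift x) (h *: (1:R)) - f x)) @ 0^' --> (df x : R).
    apply/cvgrPdist_le => /= e e0.
    have [d d0 Hd] := H x x01 e e0.
    near=> h.
    have h0 : h != 0 by near: h; exact: nbhs_dnbhs_neq.
    have hd : `|h| < Num.min d (Num.min (x - a) (b - x)).
      near: h; apply: dnbhs0_lt; rewrite !lt_min d0 !subr_gt0 ax xb //.
    move: hd; rewrite !lt_min => /and3P [hd ha hb].
    have hx : 0 <= h + x <= 1.
      apply: sub01; move: ha hb; rewrite !ltr_norml => /andP [? ?] /andP [? ?].
      by apply/andP; split; lra.
    have := Hd (h + x) hx; rewrite addrK => /(_ hd) {}Hd.
    rewrite -(ler_pM2l (x := `|h|)) ?normr_gt0 // -normrM [`|h| * e]mulrC.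
    rewrite /= [h *: 1]mulr1 mulrBr [h * (_ *: _)]mulrA divff // mul1r.
    by rewrite -normrN opprB.
  by apply: DeriveDef; [apply/cvg_ex; exists (df x) | exact: cvg_lim].
- apply/continuous_within_itvP => //.
  have C x : a <= x <= b -> forall e : R, 0 < e -> exists2 d : R, 0 < d & forall s, a <= s <= b ->
      `|s - x| < d -> `|f s - f x| < e.
    move=> /sub01 x01 e e0; have [d d0 Hd] := unit_deriv_cont (H x x01) e0.
    by exists d => // s /sub01; exact: Hd.
  split.
  + move=> x; rewrite in_itv /= => /andP [ax xb].
    apply/(cvgrPdist_lt (f : R -> R^o)) => /= e e0.
    have [|d d0 Hd] := C x _ e e0; first by rewrite !ltW.
    exists (Num.min d (Num.min (x - a) (b - x))) => /=.
      by rewrite !lt_min d0 !subr_gt0 ax xb.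
    move=> s /=; rewrite distrC !lt_min => /and3P [sd sa sb].
    rewrite distrC Hd //; move: sa sb; rewrite !ltr_norml => /andP [? ?] /andP [? ?].
    by apply/andP; split; lra.
  + apply/(cvgrPdist_lt (f : R -> R^o)) => /= e e0.
    have [|d d0 Hd] := C a _ e e0; first by rewrite lexx ltW.
    near=> s.
    have as_ : a < s by near: s; exact: nbhs_right_gt.
    have sb : s < b by near: s; exact: nbhs_right_lt.
    rewrite distrC Hd ?ltW //= ?ltW //.
    rewrite gtr0_norm ?subr_gt0 // ltrBlDl; near: s.
    by apply: nbhs_right_lt; rewrite ltrDl.
  + apply/(cvgrPdist_lt (f : R -> R^o)) => /= e e0.
    have [|d d0 Hd] := C b _ e e0; first by rewrite lexx ltW.
    near=> s.
    have as_ : a < s by near: s; exact: nbhs_left_gt.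
    have sb : s < b by near: s; exact: nbhs_left_lt.
    rewrite distrC Hd ?ltW //= ?ltW //.
    rewrite distrC gtr0_norm ?subr_gt0 // ltrBlDl -ltrBlDr; near: s.
    by apply: nbhs_left_gt; rewrite ltrBlDr ltrDl.
- rewrite in_itv /= => cab E; by exists c.
Unshelve. all: by end_near.
Qed.

End UnitDeriv.

(** * Compactness and matrix norms *)

Section Compact.
Context {R : realType}.

Lemma compact_locally_bounded {V : normedModType R} (K : set V) (f : V -> R) :
  compact K ->
  (forall x, K x -> exists2 d : R, 0 < d & exists C : R,
     forall y, K y -> `|y - x| < d -> f y <= C) ->
  exists2 C : R, 0 < C & forall x, K x -> f x <= C.
Proof.
move=> /compact_near_coveringP cK H.
have : \forall C \near +oo, K `<=` (fun x => K x -> f x <= C).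
  apply: cK => x Kx; have [d d0 [C HC]] := H x Kx.
  exists (ball x d, [set M | C <= M]); first split.
  - exact: nbhsx_ballx.
  - by apply: nbhs_pinfty_ge; rewrite num_real.
  - move=> [y M] /= [yx CM] Ky; apply: le_trans CM; apply: HC => //.
    by move: yx; rewrite -ball_normE /= distrC.
move=> [M [Mr HM]].
exists (`|M| + 1); first by rewrite ltr_wpDl.
move=> x Kx; apply: (HM (`|M| + 1)) => //.
by rewrite (le_lt_trans (ler_norm M)) // ltrDl.
Qed.

(** Local boundedness is applied to the function [f] that is [0] on the ball of radius [e] about [x]
    and [1 / |phi y - phi x|] outside it. Injectivity makes it locally bounded away from [x], and a
    bound [C] for it yields the radius [1 / C]. *)
Lemma compact_inj_inverse_cont {V W : normedModType R} (K : set V) (phi : V -> W) :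
  compact K ->
  (forall x, K x -> forall e : R, 0 < e -> exists2 d : R, 0 < d &
     forall y, `|y - x| < d -> `|phi y - phi x| < e) ->
  (forall x y, K x -> K y -> phi x = phi y -> x = y) ->
  forall x, K x -> forall e : R, 0 < e -> exists2 d : R, 0 < d &
    forall y, K y -> `|phi y - phi x| < d -> `|y - x| < e.
Proof.
move=> cK cphi inj x Kx e e0.
pose f y := if `|y - x| < e then 0 else `|phi y - phi x|^-1.
have [|C C0 HC] := @compact_locally_bounded V K f cK.
  move=> y Ky; have [->|yx] := eqVneq y x.
    by exists e => //; exists 0 => z Kz zx; rewrite /f zx.
  have m0 : 0 < `|phi y - phi x|.
    rewrite normr_gt0 subr_eq0; apply/eqP => E.
    by move/eqP : yx; apply; exact: inj.
  have [d d0 Hd] := cphi y Ky (`|phi y - phi x| / 2) ltac:(by rewrite divr_gt0).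
  exists d => //; exists (2 / `|phi y - phi x|) => z Kz /Hd zy.
  rewrite /f; case: ifP => _; first by rewrite divr_ge0.
  rewrite -[2 / _]invf_div lef_pV2 ?posrE ?divr_gt0 //.
    have := ler_normD (phi y - phi z) (phi z - phi x).
    by rewrite addrA subrK [`|phi y - phi z|]distrC; lra.
  have := ler_normD (phi y - phi z) (phi z - phi x).
  by rewrite addrA subrK [`|phi y - phi z|]distrC; lra.
exists C^-1; first by rewrite invr_gt0.
move=> y Ky yx; have := HC y Ky; rewrite /f; case: ifP => // /negbT; rewrite -leNgt => ey.
have m0 : 0 < `|phi y - phi x|.
  rewrite normr_gt0 subr_eq0; apply/eqP => E.
  by have := inj _ _ Ky Kx E => yE; move: ey; rewrite yE subrr normr0 leNgt e0.
by rewrite -[C]invrK lef_pV2 ?posrE ?invr_gt0 // leNgt yx.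
Qed.

End Compact.

Section MatrixNorm.
Context {R : realType}.

Lemma mx_norm_entry m n (M : 'M[R]_(m, n)) i j : `|M i j| <= `|M|.
Proof.
rewrite [leRHS]/Num.Def.normr /= mx_normrE.
by apply/bigmax_geP; right; exists (i, j).
Qed.

Lemma mx_norm_le m n (M : 'M[R]_(m, n)) (C : R) :
  0 <= C -> (forall i j, `|M i j| <= C) -> `|M| <= C.
Proof.
move=> C0 H; rewrite [leLHS]/Num.Def.normr /= mx_normrE.
by apply/bigmax_leP; split => // -[i j] _; exact: H.
Qed.

Lemma mx_norm_mulmx m p n (A : 'M[R]_(m, p)) (B : 'M[R]_(p, n)) :
  `|A *m B| <= p%:R * `|A| * `|B|.
Proof.
apply: mx_norm_le => [|i j]; first by rewrite !mulr_ge0.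
rewrite mxE (le_trans (ler_norm_sum _ _ _)) //.
rewrite -mulrA mulr_natl -[p in _ *+ p]card_ord -sumr_const ler_sum // => k _.
by rewrite normrM ler_pM // mx_norm_entry.
Qed.

Lemma mx_norm_tr m n (A : 'M[R]_(m, n)) : `|A^T| = `|A|.
Proof.
apply/eqP; rewrite eq_le; apply/andP; split; apply: mx_norm_le => // i j.
  by rewrite mxE mx_norm_entry.
by rewrite -[A]trmxK [A^T^T i j]mxE trmxK mx_norm_entry.
Qed.

Definition dotmx n (a b : 'rV[R]_n) : R := (a *m b^T) 0 0.

Lemma dotmxE n (a b : 'rV[R]_n) : dotmx a b = \sum_i a 0 i * b 0 i.
Proof. by rewrite /dotmx mxE; apply: eq_bigr => i _; rewrite mxE. Qed.

Lemma dotmx0 n (a : 'rV[R]_n) : dotmx a 0 = 0.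
Proof. by rewrite /dotmx trmx0 mulmx0 mxE. Qed.

Lemma dotmxC n (a b : 'rV[R]_n) : dotmx a b = dotmx b a.
Proof. by rewrite !dotmxE; apply: eq_bigr => i _; rewrite mulrC. Qed.

Lemma dotmxDr n (a b c : 'rV[R]_n) : dotmx a (b + c) = dotmx a b + dotmx a c.
Proof. by rewrite /dotmx linearD mulmxDr mxE. Qed.

Lemma dotmxBr n (a b c : 'rV[R]_n) : dotmx a (b - c) = dotmx a b - dotmx a c.
Proof. by rewrite /dotmx linearB mulmxBr !mxE. Qed.

Lemma dotmxBl n (a b c : 'rV[R]_n) : dotmx (a - b) c = dotmx a c - dotmx b c.
Proof. by rewrite dotmxC dotmxBr !(dotmxC c). Qed.

Lemma dotmxNl n (a b : 'rV[R]_n) : dotmx (- a) b = - dotmx a b.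
Proof. by rewrite /dotmx mulNmx mxE. Qed.

Lemma dotmxZr n (k : R) (a b : 'rV[R]_n) : dotmx a (k *: b) = k * dotmx a b.
Proof. by rewrite /dotmx linearZ -scalemxAr mxE. Qed.

Lemma dotmxZl n (k : R) (a b : 'rV[R]_n) : dotmx (k *: a) b = k * dotmx a b.
Proof. by rewrite dotmxC dotmxZr dotmxC. Qed.

Lemma dotmx_mulmx n (a b : 'rV[R]_n) (M : 'M[R]_n) :
  dotmx (a *m M) b = dotmx a (b *m M^T).
Proof. by rewrite /dotmx trmx_mul trmxK mulmxA. Qed.

Lemma dotmx_norm n (a b : 'rV[R]_n) : `|dotmx a b| <= n%:R * `|a| * `|b|.
Proof.
rewrite -(mx_norm_tr b); apply: le_trans (mx_norm_mulmx _ _).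
exact: mx_norm_entry.
Qed.

End MatrixNorm.

(** * Differentiating the preimage of an affine curve *)

Section InverseCurve.
Context {R : realType} {n : nat}.
Local Notation V := 'rV[R]_n.

Lemma approx_lin_cont {W : normedModType R} (f : V -> W) x (L : V -> W) (C : R) :
  approx_lin f x L -> (forall h, `|L h| <= C * `|h|) ->
  forall e : R, 0 < e -> exists2 d : R, 0 < d &
     forall y, `|y - x| < d -> `|f y - f x| < e.
Proof.
move=> fL LC e e0; have [d d0 H] := fL 1 ltr01.
have C0 : 0 < `|C| + 1 by rewrite ltr_wpDl.
exists (Num.min d (e / (1 + (`|C| + 1)))); first by rewrite lt_min d0 divr_gt0 // addr_gt0.
move=> y; rewrite lt_min => /andP [yd ye].
rewrite -[f y - f x](subrK (L (y - x))) (le_lt_trans (ler_normD _ _)) //.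
rewrite (le_lt_trans (lerD (H y yd) (LC _))) //.
rewrite -mulrDl mulrC; move: ye; rewrite ltr_pdivlMr ?(addr_gt0 ltr01 C0) // => ye.
apply: le_lt_trans ye; rewrite ler_wpM2l // lerD2l.
by rewrite (le_trans (ler_norm _)) // lerDl.
Qed.

(** By compactness and injectivity [gam s] is close to [gam t], so [phi] can be expanded at [gam t];
    multiplying by the inverse of [J] solves for [gam s - gam t] up to a remainder proportional to
    its norm. *)
Lemma unit_deriv_inverse_curve (K : set V) (phi : V -> V) (J : V -> 'M[R]_n)
    (gam : R -> V) (a e : V) :
  compact K ->
  (forall x, K x -> approx_lin phi x (fun h => h *m J x)) ->
  (forall x, K x -> J x \in unitmx) ->
  (forall x y, K x -> K y -> phi x = phi y -> x = y) ->
  (forall s, 0 <= s <= 1 -> K (gam s)) ->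
  (forall s, 0 <= s <= 1 -> phi (gam s) = a + s *: e) ->
  forall t, 0 <= t <= 1 -> unit_deriv gam t (e *m invmx (J (gam t))).
Proof.
move=> cK phiJ Junit inj Kg phig t t01 eps eps0.
have Kt := Kg t t01.
have phic x : K x -> forall e : R, 0 < e -> exists2 d : R, 0 < d &
     forall y, `|y - x| < d -> `|phi y - phi x| < e.
  move=> Kx; apply: (approx_lin_cont (phiJ x Kx) (C := n%:R * `|J x|)) => h.
  by rewrite mulrAC; exact: mx_norm_mulmx.
set x := gam t in Kt *; set Ji := invmx (J x).
set c := n%:R * `|Ji|.
have c0 : 0 <= c by rewrite mulr_ge0.
have boundJi (h : V) : `|h *m Ji| <= c * `|h|.
  by rewrite /c mulrAC; exact: mx_norm_mulmx.
have e1 : 0 < `|e| + 1 by rewrite ltr_wpDl.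
have c1 : 0 < c + 1 by rewrite ltr_wpDl.
(* The first bound gives [c * e' <= 1 / 2], so that [|u|] is absorbed in its own estimate; the
   second brings the remainder below [eps * |s - t|]. *)
set e' := Num.min (1 / (2 * (c + 1))) (eps / (2 * (c + 1) ^+ 2 * (`|e| + 1))).
have e'0 : 0 < e'.
  by rewrite lt_min !divr_gt0 ?mulr_gt0 // exprn_gt0.
have [d1 d10 H1] := phiJ x Kt e' e'0.
have [d2 d20 H2] := compact_inj_inverse_cont cK phic inj Kt d10.
exists (d2 / (`|e| + 1)); first by rewrite divr_gt0.
move=> s s01; rewrite ltr_pdivlMr // => st.
have Ks := Kg s s01.
have dphi : phi (gam s) - phi x = (s - t) *: e.
  by rewrite !phig // opprD addrACA subrr add0r scalerBl.
have yx : `|gam s - x| < d1.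
  apply: H2 => //; rewrite dphi normrZ; apply: le_lt_trans st.
  by rewrite ler_wpM2l // lerDl.
have {H1}H1 := H1 _ yx; rewrite dphi in H1.
set u := gam s - x in yx H1 *; set r := (s - t) *: e - u *m J x in H1.
have uE : u - (s - t) *: (e *m Ji) = - (r *m Ji).
  by rewrite /r mulmxBl -mulmxA mulmxV ?Junit // mulmx1 opprB scalemxAl.
have ub : `|u| <= 2 * c * (`|s - t| * `|e|).
  have : `|u| <= c * (`|s - t| * `|e|) + c * (e' * `|u|).
    rewrite -{1}[u](subrK ((s - t) *: (e *m Ji))) uE.
    rewrite (le_trans (ler_normD _ _)) // normrN addrC lerD //.
      rewrite normrZ (le_trans (ler_wpM2l _ (boundJi _))) //.
      by rewrite mulrCA.
    by rewrite (le_trans (boundJi _)) // ler_wpM2l.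
  have : c * (e' * `|u|) <= `|u| / 2.
    rewrite mulrA [leRHS]mulrC ler_wpM2r //.
    have : e' <= 1 / (2 * (c + 1)) by rewrite ge_min lexx.
    rewrite ler_pdivlMr ?mulr_gt0 // => h.
    have := mulr_ge0 c0 (ltW e'0); nra.
  by lra.
rewrite uE normrN (le_trans (boundJi _)) //.
rewrite (le_trans (ler_wpM2l c0 H1)) // mulrA.
rewrite (le_trans (ler_wpM2l _ ub)) ?mulr_ge0 // ?(ltW e'0) //.
rewrite [leLHS](_ : _ = (2 * c ^+ 2 * `|e| * e') * `|s - t|); last by ring.
rewrite ler_wpM2r //.
have : e' <= eps / (2 * (c + 1) ^+ 2 * (`|e| + 1)) by rewrite ge_min lexx orbT.
rewrite ler_pdivlMr ?mulr_gt0 ?exprn_gt0 // mulrC; apply: le_trans.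
rewrite ler_wpM2r ?(ltW e'0) // ler_pM ?mulr_ge0 ?exprn_ge0 // ?lerDl //.
by rewrite ler_wpM2l // lerXn2r ?nnegrE // ?lerDl // ltW.
Qed.

End InverseCurve.

(** * Relative interiors of convex sets *)

Section Convex.
Context {R : realType} {n : nat}.
Local Notation V := 'rV[R]_n.
Implicit Types (S : set V) (q w z : V).

(** The point [q] carries the missing weight, so the coefficients need only sum to at most 1. The
    induction splits off [p a] and rescales the other weights by [1 / (1 - k a)]. *)
Lemma convex_comb S q (I : Type) (s : seq I) (k : I -> R) (p : I -> V) :
  convex_set_of S -> S q -> (forall i, S (q + p i)) ->
  (forall i, 0 <= k i) -> \sum_(i <- s) k i <= 1 ->
  S (q + \sum_(i <- s) k i *: p i).
Proof.
move=> cS Sq Sp; elim: s k => [|a s IH] k k0; first by rewrite !big_nil addr0.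
rewrite !big_cons => ks.
have sum0 : 0 <= \sum_(i <- s) k i by apply: sumr_ge0.
have [ka1|ka1] := ltrP (k a) 1.
  have k1 : 0 < 1 - k a by rewrite subr_gt0.
  have Sc : S (q + \sum_(i <- s) (k i / (1 - k a)) *: p i).
    apply: IH => [i|]; first by rewrite divr_ge0 // ltW.
    by rewrite -mulr_suml ler_pdivrMr // mul1r lerBrDl.
  have := cS _ _ Sc (Sp a) (k a).
  rewrite k0 (ltW ka1) => /(_ isT); congr (S _).
  rewrite !scalerDr addrACA -scalerDl subrK scale1r; congr (_ + _).
  rewrite addrC; congr (_ + _); rewrite scaler_sumr.
  by apply: eq_bigr => i _; rewrite scalerA mulrCA divff ?mulr1 // gt_eqF.
(* All the weight sits on [a]; the other coefficients are nonnegative with sum [0], hence vanish. *)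
have kaE : k a = 1 by apply/eqP; rewrite eq_le ka1 andbT; lra.
have : \sum_(i <- s) k i == 0 by rewrite eq_le sum0 andbT; lra.
move=> /eqP s0.
suff -> : \sum_(i <- s) k i *: p i = 0 by rewrite kaE scale1r addr0.
elim: s {IH ks sum0} s0 => [|b s IHs]; first by rewrite !big_nil.
rewrite !big_cons => s0.
have sum0 : 0 <= \sum_(i <- s) k i by apply: sumr_ge0.
have kb := k0 b.
have -> : k b = 0 by lra.
by rewrite scale0r add0r IHs //; lra.
Qed.

Definition directions S m (M : 'M[R]_(m, n)) :=
  forall s s', S s -> S s' -> (s - s' <= M)%MS.

(* When [M] spans [S - S] and [r > 0], [q] is in the relative interior of [S]. *)
Definition room S m (M : 'M[R]_(m, n)) (r : R) q :=
  forall w, (w <= M)%MS -> `|w| <= r -> S (q + w).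

(** Among the matrices whose rows lie in [S - q], take one of maximal rank: a difference [s - q]
    outside its row space could be appended and would raise the rank. *)
Lemma affine_basis_exists S q : S q ->
  exists m (M : 'M[R]_(m, n)), (forall i, S (q + row i M)) /\ directions S M.
Proof.
move=> Sq.
pose P r := `[< exists m (M : 'M[R]_(m, n)),
  (forall i, S (q + row i M)) /\ \rank M = r >].
have exP : exists r, P r.
  exists 0%N; apply/asboolP; exists 0%N, 0; split; last by rewrite mxrank0.
  by case.
have Pn r : P r -> (r <= n)%N.
  by move=> /asboolP [m [M [_ <-]]]; exact: rank_leq_col.
case: (ex_maxnP exP Pn) => r /asboolP [m [M [SM rM]]] rmax.
exists m, M; split => //.
have sub s : S s -> (s - q <= M)%MS.
  move=> Ss; apply/negPn/negP => nsM.
  have : P (\rank (col_mx M (s - q))).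
    apply/asboolP; exists (m + 1)%N, (col_mx M (s - q)); split => // i.
    case: (split_ordP i) => j ->; first (rewrite (rowKu j M (s - q)); exact: SM).
    rewrite (rowKd j M (s - q)) (_ : row j (s - q) = s - q); first by rewrite addrC subrK.
    by apply/rowP => k; rewrite mxE ord1.
  move=> /rmax; rewrite leqNgt => /negP; apply.
  rewrite -rM -addsmxE; apply: rank_ltmx.
  rewrite ltmxE addsmxSl /=; apply: contra nsM; apply: submx_trans.
  exact: addsmxSr.
move=> s s' /sub Ms /sub Ms'.
have -> : s - s' = (s - q) + (-1) *: (s' - q) by rewrite scaleN1r opprB addrA subrK.
by rewrite addmx_sub // scalemx_sub.
Qed.

(* The witness is the barycentre of an affine basis. *)
Lemma relative_interior_exists S q : convex_set_of S -> S q ->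
  exists m (M : 'M[R]_(m, n)), directions S M /\
    exists z, exists2 r : R, 0 < r & room S M r z.
Proof.
move=> cS Sq; have [m [M [SM dM]]] := affine_basis_exists Sq.
exists m, M; split => //.
pose h : R := (m.+1)%:R^-1.
have m0 : 0 < (m.+1)%:R :> R by rewrite ltr0n.
have h0 : 0 < h by rewrite invr_gt0.
pose B' := n%:R * `|pinvmx M| : R.
have B0 : 0 <= B' by rewrite mulr_ge0.
(* With this radius the coordinates of [w] in the rows of [M] are at most [h ^+ 2 <= h], so the new
   weights stay nonnegative and sum to at most [m (h + h ^+ 2) = 1 - h ^+ 2]. *)
exists (q + \sum_i h *: row i M), (h ^+ 2 / (B' + 1)).
  by rewrite divr_gt0 ?exprn_gt0 // ltr_wpDl.
move=> w wM wr.
pose k := w *m pinvmx M.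
have kb i : `|k 0 i| <= h ^+ 2.
  apply: (le_trans (mx_norm_entry _ _ _)).
  apply: (le_trans (mx_norm_mulmx _ _)).
  rewrite mulrAC -/B'; move: wr; rewrite ler_pdivlMr ?ltr_wpDl // => wr.
  by apply: le_trans wr; rewrite mulrC ler_wpM2l // lerDl.
have h1 : h * (m.+1)%:R = 1 by rewrite mulVf // gt_eqF.
have hle : h <= 1 by rewrite invf_le1 // ler1n.
have -> : q + \sum_i h *: row i M + w = q + \sum_i (h + k 0 i) *: row i M.
  rewrite -addrA; congr (_ + _); rewrite -[in LHS](mulmxKpV wM) mulmx_sum_row.
  by rewrite -big_split /=; apply: eq_bigr => i _; rewrite scalerDl.
apply: convex_comb => // [i|].
  have := kb i; rewrite ler_norml => /andP [+ _].
  have : h ^+ 2 <= h by rewrite expr2 ger_pMl.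
  by lra.
have : \sum_i (h + k 0 i) <= \sum_(i < m) (h + h ^+ 2).
  by apply: ler_sum => i _; rewrite lerD2l (le_trans (ler_norm _)).
move=> /le_trans; apply; rewrite sumr_const card_ord -mulr_natr.
have mE : m%:R = (m.+1)%:R - 1 :> R by rewrite -natr1 addrK.
rewrite mE; move: h1; set N := (m.+1)%:R => h1.
have -> : (h + h ^+ 2) * (N - 1) = (h * N) * (1 + h) - h - h ^+ 2 by ring.
by rewrite h1; have := sqr_ge0 h; lra.
Qed.

Lemma room_mem S m (M : 'M[R]_(m, n)) r q : 0 <= r -> room S M r q -> S q.
Proof. by move=> r0 /(_ 0); rewrite addr0 sub0mx normr0 => /(_ isT r0). Qed.

Lemma room_comb S m (M : 'M[R]_(m, n)) r q q' (t : R) :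
  convex_set_of S -> 0 <= t <= 1 ->
  room S M r q -> room S M r q' -> room S M r ((1 - t) *: q + t *: q').
Proof.
move=> cS t01 rq rq' w wM wr.
have := cS _ _ (rq w wM wr) (rq' w wM wr) t t01; congr (S _).
by rewrite !scalerDr addrACA -scalerDl subrK scale1r.
Qed.

Lemma room_segment S m (M : 'M[R]_(m, n)) r q z (t : R) :
  convex_set_of S -> 0 < t <= 1 -> S q -> room S M r z ->
  room S M (t * r) ((1 - t) *: q + t *: z).
Proof.
move=> cS /andP [t0 t1] Sq rz w wM wr.
have Sz : S (z + t^-1 *: w).
  apply: rz; first exact: scalemx_sub.
  by rewrite normrZ gtr0_norm ?invr_gt0 // ler_pdivrMl.
have := cS _ _ Sq Sz t; rewrite (ltW t0) t1 => /(_ isT); congr (S _).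
by rewrite scalerDr scalerA divff ?gt_eqF // scale1r addrA.
Qed.

Lemma room_shift S m (M : 'M[R]_(m, n)) r r' q u :
  room S M r q -> (u <= M)%MS -> `|u| <= r' -> room S M (r - r') (q + u).
Proof.
move=> rq uM ur w wM wr; rewrite -addrA; apply: rq; first exact: addmx_sub.
by rewrite (le_trans (ler_normD _ _)) //; lra.
Qed.

(** The supremum of [dotmx a] over the unit ball of the row space is the norm of this functional;
    [d] reaches at least half of it, whence the factor 2. *)
Lemma near_norming_direction (a : V) m (M : 'M[R]_(m, n)) :
  exists d, [/\ (d <= M)%MS, `|d| <= 1 &
    forall w, (w <= M)%MS -> `|dotmx a w| <= 2 * dotmx a d * `|w|].
Proof.
pose E := [set x | exists2 w, (w <= M)%MS /\ `|w| <= 1 & x = dotmx a w].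
have E0 : E 0.
  by exists 0; rewrite ?sub0mx ?normr0 ?ler01 // dotmx0.
have Eub : has_ubound E.
  exists (n%:R * `|a|) => _ [w [_ w1] ->].
  rewrite (le_trans (ler_norm _)) // (le_trans (dotmx_norm _ _)) //.
  by rewrite -[leRHS]mulr1 ler_wpM2l // mulr_ge0.
have s0 : 0 <= sup E by exact: ub_le_sup.
have bnd w : (w <= M)%MS -> `|dotmx a w| <= sup E * `|w|.
  move=> wM; have [->|w0] := eqVneq w 0.
    by rewrite dotmx0 normr0 mulr_ge0.
  have nw : 0 < `|w| by rewrite normr_gt0.
  have H (k : R) : `|k| = `|w|^-1 -> k * dotmx a w <= sup E.
    move=> kE; apply: ub_le_sup => //; exists (k *: w); last by rewrite dotmxZr.
    by rewrite scalemx_sub // normrZ kE mulVf ?gt_eqF.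
  rewrite -ler_pdivrMr //; have [_|_] := ger0P (dotmx a w).
    by rewrite mulrC H // normfV normr_id.
  by rewrite mulrC mulrN -mulNr H // normrN normfV normr_id.
have [sE|sE] := eqVneq (sup E) 0.
  exists 0; rewrite sub0mx normr0; split => // w wM.
  by rewrite dotmx0 mulr0 mul0r -(mul0r `|w|) -sE bnd.
have sp : 0 < sup E / 2 by rewrite divr_gt0 // lt_def sE.
have [_ [d [dM d1] ->] dE] := sup_adherent sp (conj (ex_intro _ 0 E0) Eub).
exists d; split => // w wM; rewrite (le_trans (bnd w wM)) // ler_wpM2r //.
by lra.
Qed.

End Convex.

(** * c-segments *)

Section Curves.
Context {R : realType} {n : nat}.
Local Notation V := 'rV[R]_n.

Lemma unit_deriv_mulmx (f : V -> V) (g : R -> V) t (M : 'M[R]_n) l :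
  approx_lin f (g t) (fun h => h *m M) -> unit_deriv g t l ->
  unit_deriv (f \o g) t (l *m M).
Proof.
move=> fM gl; apply: (unit_deriv_comp (L := fun h => h *m M)
  (C := n%:R * `|M|) _ fM _ gl) => [u k v|h].
  by rewrite mulmxBl scalemxAl.
by rewrite mulrAC; exact: mx_norm_mulmx.
Qed.

Lemma unit_deriv_dotmx (f : V -> R) (g : R -> V) t (a l : V) :
  approx_lin (W := R^o) f (g t) (dotmx a) -> unit_deriv g t l ->
  unit_deriv (V := R^o) (f \o g) t (dotmx a l).
Proof.
move=> fa gl; apply: (@unit_deriv_comp R V R^o f g t (dotmx a) l
  (n%:R * `|a|) _ fa _ gl) => [u k v|h].
  by rewrite dotmxBr dotmxZr.
exact: dotmx_norm.
Qed.

Lemma unit_deriv_dotl (g : R -> V) t (a l : V) :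
  unit_deriv g t l -> unit_deriv (V := R^o) (fun s => dotmx (g s) a) t (dotmx l a).
Proof.
move=> gl; rewrite dotmxC.
apply: (unit_deriv_dotmx (f := fun v => dotmx v a) _ gl) => e e0.
exists 1 => // y _; rewrite -dotmxBl dotmxC subrr normr0.
by rewrite mulr_ge0 // ltW.
Qed.

(** The norm is the maximum of the entries, so the scalar mean value theorem serves each coordinate
    with its own intermediate point. *)
Lemma unit_mean_value (g l : R -> V) (C : R) : 0 <= C ->
  (forall t, 0 <= t <= 1 -> unit_deriv g t (l t)) ->
  (forall t, 0 <= t <= 1 -> `|l t| <= C) -> `|g 1 - g 0| <= C.
Proof.
move=> C0 gl lC; apply: mx_norm_le => // i j; rewrite ord1 {i}.
have dj t : 0 <= t <= 1 -> unit_deriv (V := R^o) (fun s => g s 0 j) t (l t 0 j).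
  move=> t01 e e0; have [d d0 H] := gl t t01 e e0.
  exists d => // s s01 sd; apply: le_trans (H s s01 sd).
  by apply: le_trans (mx_norm_entry _ 0 j); rewrite !mxE.
have [c /andP [c0 c1]] := unit_mvt dj (lexx 0) ltr01 (lexx 1).
rewrite !mxE subr0 mulr1 => ->.
by rewrite (le_trans (mx_norm_entry _ 0 j)) // lC // !ltW.
Qed.

End Curves.

(** * Inverse of an injective map on a compact set with convex image *)

Section InverseMap.
Context {R : realType} {n : nat}.
Local Notation V := 'rV[R]_n.
Variables (K : set V) (phi : V -> V) (J : V -> 'M[R]_n).
Hypothesis cK : compact K.
Hypothesis phiJ : forall x, K x -> approx_lin phi x (fun h => h *m J x).
Hypothesis Junit : forall x, K x -> J x \in unitmx.
Hypothesis phi_inj : forall x y, K x -> K y -> phi x = phi y -> x = y.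
Hypothesis cS : convex_set_of (phi @` K).

(** The value off the image is [0], so that for [phi y = - Dx c x y] this unfolds to
    [cexp c Y x]. *)
Definition inv_on (s : V) : V := xget 0 [set x | K x /\ phi x = s].

Lemma inv_onP s : (phi @` K) s -> K (inv_on s) /\ phi (inv_on s) = s.
Proof.
move=> [x Kx xs]; rewrite /inv_on.
by case: (xgetP 0 [set x | K x /\ phi x = s]) => [y -> //|/(_ x)]; case.
Qed.

Lemma inv_onK x : K x -> inv_on (phi x) = x.
Proof.
move=> Kx; have [|Ki E] := @inv_onP (phi x); first by exists x.
exact: phi_inj.
Qed.

Lemma image_segment s e t : (phi @` K) s -> (phi @` K) (s + e) -> 0 <= t <= 1 ->
  (phi @` K) (s + t *: e).
Proof.
move=> Ss Se t01; have := cS Ss Se t01; congr (_ _).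
by rewrite scalerBl scale1r scalerDr addrA subrK.
Qed.

Lemma inv_on_curve s e t : (phi @` K) s -> (phi @` K) (s + e) -> 0 <= t <= 1 ->
  unit_deriv (fun t => inv_on (s + t *: e)) t
    (e *m invmx (J (inv_on (s + t *: e)))).
Proof.
move=> Ss Se t01.
apply: (unit_deriv_inverse_curve (K := K) (phi := phi)
  (gam := fun t => inv_on (s + t *: e)) (a := s)) => // u u01.
- by have [] := inv_onP (image_segment Ss Se u01).
- by have [] := inv_onP (image_segment Ss Se u01).
Qed.

(** Convexity keeps the segment from [s] to [s'] in the image, where the derivative of the inverse
    is controlled by [C]. *)
Lemma inv_on_lipschitz (C : R) s s' : (forall x, K x -> `|invmx (J x)| <= C) ->
  (phi @` K) s -> (phi @` K) s' ->
  `|inv_on s' - inv_on s| <= n%:R * C * `|s' - s|.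
Proof.
move=> JC Ss Ss'.
have Se : (phi @` K) (s + (s' - s)) by rewrite addrC subrK.
have [Ks _] := inv_onP Ss.
have C0 : 0 <= C by apply: le_trans (JC _ Ks).
have := @unit_mean_value R n (fun t => inv_on (s + t *: (s' - s)))
  (fun t => (s' - s) *m invmx (J (inv_on (s + t *: (s' - s)))))
  (n%:R * C * `|s' - s|).
rewrite scale1r scale0r addr0 [s + _]addrC subrK; apply.
- by rewrite !mulr_ge0.
- by move=> t t01; exact: inv_on_curve.
- move=> t t01; apply: (le_trans (mx_norm_mulmx _ _)).
  rewrite mulrAC ler_wpM2r // ler_wpM2l // JC //.
  by have [] := inv_onP (image_segment Ss Se t01).
Qed.

End InverseMap.

(** * Perturbation of inverse matrices, and closedness of subspaces *)

Section MatrixPerturbation.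
Context {R : realType} {n : nat}.

Lemma invmx_sub (A B : 'M[R]_n) : A \in unitmx -> B \in unitmx ->
  invmx A - invmx B = invmx A *m (B - A) *m invmx B.
Proof.
move=> Au Bu; rewrite mulmxBr mulVmx // mulmxBl mul1mx -mulmxA mulmxV //.
by rewrite mulmx1.
Qed.

Lemma mulmx_norm3 (m : nat) (A : 'M[R]_(m, n)) (B C : 'M[R]_n) :
  `|A *m B *m C| <= n%:R ^+ 2 * (`|A| * `|B| * `|C|).
Proof.
apply: (le_trans (mx_norm_mulmx _ _)).
rewrite [leRHS](_ : _ = n%:R * (n%:R * `|A| * `|B|) * `|C|); last by ring.
by rewrite ler_wpM2r // ler_wpM2l // mx_norm_mulmx.
Qed.

(** By [invmx_sub] the two inverses differ by at most half of [|invmx B|], which is absorbed on the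
    left. *)
Lemma invmx_locally_bounded (A B : 'M[R]_n) : A \in unitmx -> B \in unitmx ->
  `|B - A| * (2 * n%:R ^+ 2 * (`|invmx A| + 1)) <= 1 ->
  `|invmx B| <= 2 * `|invmx A|.
Proof.
move=> Au Bu BA.
have := mulmx_norm3 (invmx B) (A - B) (invmx A).
rewrite -invmx_sub // => h1.
have h2 : `|invmx B| <= `|invmx B - invmx A| + `|invmx A|.
  by rewrite -{1}[invmx B](subrK (invmx A)) ler_normD.
have h3 : n%:R ^+ 2 * (`|invmx B| * `|A - B| * `|invmx A|) <= `|invmx B| / 2.
  rewrite [leLHS](_ : _ = `|invmx B| * (`|A - B| * (n%:R ^+ 2 * `|invmx A|))); last by ring.
  rewrite ler_wpM2l // distrC.
  have : 0 <= `|B - A| * n%:R ^+ 2 by rewrite mulr_ge0 // exprn_ge0.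
  by move: BA; nra.
by lra.
Qed.

(** The cokernel of [M] turns membership in the row space into an equation, which passes to the
    limit of difference quotients. *)
Lemma unit_deriv_submx (g : R -> 'rV[R]_n) l m (M : 'M[R]_(m, n)) :
  unit_deriv g 0 l -> (forall h, 0 <= h <= 1 -> (g h - g 0 <= M)%MS) ->
  (l <= M)%MS.
Proof.
move=> gl gM; rewrite submxE -normr_eq0; apply/eqP/le_anti; rewrite normr_ge0 andbT.
set k := cokermx M.
have K0 : 0 < n%:R * `|k| + 1 by rewrite ltr_wpDl // mulr_ge0.
apply/ler_addgt0Pr => e e0; rewrite add0r.
have [d d0 H] := gl (e / (n%:R * `|k| + 1)) ltac:(by rewrite divr_gt0).
pose h := Num.min 1 (d / 2).
have h0 : 0 < h by rewrite lt_min ltr01 divr_gt0.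
have h01 : 0 <= h <= 1 by rewrite ltW //= ge_min lexx.
have hd : `|h - 0| < d.
  rewrite subr0 gtr0_norm // gt_min; apply/orP; right.
  by rewrite ltr_pdivrMr // mulr_natr mulr2n ltrDl.
have {H}H := H h h01 hd; rewrite subr0 (gtr0_norm h0) in H.
set r := g h - g 0 - h *: l in H.
have gk : (g h - g 0) *m k = 0 by apply/eqP; rewrite -submxE gM.
have lk : h *: (l *m k) = - (r *m k).
  by rewrite /r mulmxBl gk sub0r opprK scalemxAl.
rewrite -(ler_pM2l h0) -{1}(gtr0_norm h0) -normrZ lk normrN.
apply: (le_trans (mx_norm_mulmx _ _)).
rewrite mulrAC (le_trans (ler_wpM2l _ H)) ?mulr_ge0 //.
rewrite [leLHS](_ : _ = h * (e * (n%:R * `|k| / (n%:R * `|k| + 1)))); last by ring.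
rewrite ler_wpM2l ?(ltW h0) // -[leRHS]mulr1 ler_wpM2l ?(ltW e0) //.
by rewrite ler_pdivrMr // mul1r lerDl.
Qed.

End MatrixPerturbation.

(** The induction step of [slope_segment]: [a0], [a], [b] are the slopes at the start and at two
    consecutive points, [u] and [h] the rescaled elapsed parameter and step. Once [b > 0] is known,
    it rests on [(1 - h) / (1 + h) >= 1 - 2 h] and [(1 - 2 h) (1 - 2 u) >= 1 - 2 u - 2 h]. *)
Lemma one_step_decay {R : realFieldType} (u h a0 a b : R) :
  0 <= u -> 0 <= h -> 2 * u + 2 * h <= 1 / 2 -> 0 < a0 ->
  (1 - 2 * u) * a0 <= a -> a - h * a <= b + h * `|b| ->
  (1 - (2 * u + 2 * h)) * a0 <= b.
Proof.
move=> u0 h0 uh a00 a0a ab.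
have ap : 0 < a by apply: lt_le_trans a0a; rewrite mulr_gt0 //; lra.
have hap := mulr_ge0 h0 (ltW ap).
have huap : 0 <= h * u * a0 by rewrite !mulr_ge0 // ltW.
have h2a : 0 <= h * h * a by rewrite !mulr_ge0 // ltW.
have bp : 0 < b.
  rewrite ltNge; apply/negP => b0; move: ab; rewrite (ler0_norm b0).
  have : 0 < (1 - h) * a by rewrite mulr_gt0 //; lra.
  have : (1 - h) * b <= 0 by rewrite mulr_ge0_le0 //; lra.
  by lra.
move: ab; rewrite (gtr0_norm bp) => ab.
have h1 : 0 < 1 + h by lra.
have step : (1 - 2 * h) * a <= b by rewrite -(ler_pM2l h1); lra.
have : (1 - 2 * h) * ((1 - 2 * u) * a0) <= (1 - 2 * h) * a by rewrite ler_wpM2l //; lra.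
by lra.
Qed.

(** * Quantitative quasi-convexity *)

Section Cost.
Context {R : realType} {n : nat}.
Local Notation V := 'rV[R]_n.
Variables (X Y : set V) (c : V -> V -> R) (p q : V -> V -> V).
Variables (A : V -> V -> 'M[R]_n) (L : R).
Hypothesis cX : compact X.
Hypothesis cY : compact Y.
Hypothesis c_x : forall x y, X x -> Y y ->
  approx_lin (W := R^o) (fun x' => c x' y) x (dotmx (- p x y)).
Hypothesis c_y : forall x y, X x -> Y y ->
  approx_lin (W := R^o) (fun y' => c x y') y (dotmx (- q x y)).
Hypothesis p_y : forall x y, X x -> Y y ->
  approx_lin (p x) y (fun h => h *m (A x y)^T).
Hypothesis q_x : forall x y, X x -> Y y ->
  approx_lin (q ^~ y) x (fun w => w *m A x y).
Hypothesis A_unit : forall x y, X x -> Y y -> A x y \in unitmx.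
Hypothesis p_inj : forall x y y', X x -> Y y -> Y y' -> p x y = p x y' -> y = y'.
Hypothesis q_inj : forall y x x', Y y -> X x -> X x' -> q x y = q x' y -> x = x'.
Hypothesis L0 : 0 <= L.
Hypothesis A_lip : forall x x' y y', X x -> X x' -> Y y -> Y y' ->
  `|A x y - A x' y'| <= L * (`|x - x'| + `|y - y'|).
Hypothesis cvY : forall x, X x -> convex_set_of (p x @` Y).
Hypothesis cvX : forall y, Y y -> convex_set_of ((q ^~ y) @` X).

Local Notation yexp x := (inv_on Y (p x)).
Local Notation xexp y := (inv_on X (q ^~ y)).

Hypothesis loeper : forall x x0 y0 y1 t, X x -> X x0 -> Y y0 -> Y y1 -> 0 <= t <= 1 ->
  let yt := yexp x0 (p x0 y0 + t *: (p x0 y1 - p x0 y0)) in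
  - c x yt + c x0 yt <= Num.max (- c x y1 + c x0 y1) (- c x y0 + c x0 y0).

(** * Uniform bounds on the Hessian and on the c-exponential maps *)

Lemma hessian_bounds : exists2 C : R, 0 < C &
  forall x y, X x -> Y y -> `|A x y| <= C /\ `|invmx (A x y)| <= C.
Proof.
have cXY := compact_setX cX cY.
have near_A (z z' : V * V) : X z.1 -> X z'.1 -> Y z.2 -> Y z'.2 ->
    `|A z'.1 z'.2 - A z.1 z.2| <= 2 * L * `|z' - z|.
  move=> ? ? ? ?; apply: (le_trans (A_lip _ _ _ _)) => //.
  rewrite [leRHS](_ : _ = L * (`|z' - z| + `|z' - z|)); last by ring.
  rewrite ler_wpM2l // lerD //.
    by rewrite prod_normE /= le_max lexx.
  by rewrite prod_normE /= le_max lexx orbT.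
have [|C1 C10 HC1] := @compact_locally_bounded R (V * V)%type _ (fun z => `|A z.1 z.2|) cXY.
  move=> z [Xz Yz]; exists 1 => //; exists (`|A z.1 z.2| + 2 * L) => z' [Xz' Yz'] zz.
  rewrite -[A z'.1 _](subrK (A z.1 z.2)) addrC (le_trans (ler_normD _ _)) // lerD2l.
  rewrite (le_trans (near_A _ _ _ _ _ _)) // -[leRHS]mulr1 ler_wpM2l ?mulr_ge0 //.
  exact: ltW.
have [|C2 C20 HC2] := @compact_locally_bounded R (V * V)%type _ (fun z => `|invmx (A z.1 z.2)|) cXY.
  move=> z [Xz Yz].
  set K := (2 * L + 1) * (2 * n%:R ^+ 2 * (`|invmx (A z.1 z.2)| + 1) + 1).
  have k0 : 0 <= 2 * n%:R ^+ 2 * (`|invmx (A z.1 z.2)| + 1).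
    by rewrite !mulr_ge0 // ?exprn_ge0 // addr_ge0.
  have K0 : 0 < K by rewrite mulr_gt0 // ltr_wpDl // mulr_ge0.
  exists K^-1; first by rewrite invr_gt0.
  exists (2 * `|invmx (A z.1 z.2)|) => z' [Xz' Yz'] zz.
  apply: invmx_locally_bounded; [exact: A_unit|exact: A_unit|].
  apply: (le_trans (ler_wpM2r k0 (near_A z z' Xz Xz' Yz Yz'))).
  move: zz; rewrite -[K^-1]mul1r ltr_pdivlMr // => /ltW; apply: le_trans.
  rewrite /K [2 * L * _ * _]mulrAC mulrC ler_wpM2l //.
  have H (k : R) : 0 <= k -> 2 * L * k <= (2 * L + 1) * (k + 1).
    by move=> kp; have := L0; lra.
  exact: H.
exists (C1 + C2); first exact: addr_gt0.
move=> x y Xx Yy; split.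
  by have /= := HC1 (x, y) (conj Xx Yy) => /= h; rewrite (le_trans h) // lerDl ltW.
by have := HC2 (x, y) (conj Xx Yy) => /= h; rewrite (le_trans h) // lerDr ltW.
Qed.

Lemma yexp_curve x y0 y1 t : X x -> Y y0 -> Y y1 -> 0 <= t <= 1 ->
  let yt := fun t => yexp x (p x y0 + t *: (p x y1 - p x y0)) in
  [/\ Y (yt t), p x (yt t) = p x y0 + t *: (p x y1 - p x y0) &
    unit_deriv yt t ((p x y1 - p x y0) *m (invmx (A x (yt t)))^T)].
Proof.
move=> Xx Yy0 Yy1 t01 yt.
have S0 : (p x @` Y) (p x y0) by exists y0.
have S1 : (p x @` Y) (p x y0 + (p x y1 - p x y0)) by exists y1 => //; rewrite addrC subrK.
have [Yt pt] := inv_onP (image_segment (cvY Xx) S0 S1 t01).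
split => //.
rewrite trmx_inv; apply: (@inv_on_curve R n Y (p x) (fun y => (A x y)^T)) => //.
- by move=> y Yy; exact: p_y.
- by move=> y Yy; rewrite unitmx_tr A_unit.
- by move=> y y' Yy Yy'; exact: p_inj.
- exact: cvY.
Qed.

Lemma yexpK x y : X x -> Y y -> yexp x (p x y) = y.
Proof. by move=> Xx Yy; apply: inv_onK => // u v Yu Yv; exact: p_inj. Qed.

Lemma xexpK x y : X x -> Y y -> xexp y (q x y) = x.
Proof. by move=> Xx Yy; apply: (@inv_onK _ _ X (q ^~ y)) => // u v Xu Xv; exact: q_inj. Qed.

Lemma xexpP y s : ((q ^~ y) @` X) s -> X (xexp y s) /\ q (xexp y s) y = s.
Proof. by move=> /inv_onP. Qed.

Lemma xexp_curve y s e t : Y y -> ((q ^~ y) @` X) s -> ((q ^~ y) @` X) (s + e) ->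
  0 <= t <= 1 ->
  ((q ^~ y) @` X) (s + t *: e) /\
  unit_deriv (fun t => xexp y (s + t *: e)) t
    (e *m invmx (A (xexp y (s + t *: e)) y)).
Proof.
move=> Yy Ss Se t01; split; first by apply: (@image_segment R n X (q ^~ y)) => //; exact: cvX.
apply: (@inv_on_curve R n X (q ^~ y) (fun x => A x y)) => //.
- by move=> x Xx; exact: q_x.
- by move=> x Xx; exact: A_unit.
- by move=> x x' Xx Xx'; exact: q_inj.
- exact: cvX.
Qed.

Lemma xexp_lipschitz : exists2 C : R, 0 < C & forall y s s', Y y ->
  ((q ^~ y) @` X) s -> ((q ^~ y) @` X) s' ->
  `|xexp y s' - xexp y s| <= C * `|s' - s|.
Proof.
have [C C0 HC] := hessian_bounds.
exists (n%:R * C + 1); first by rewrite ltr_wpDl // mulr_ge0 // ltW.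
move=> y s s' Yy Ss Ss'.
apply: (le_trans (@inv_on_lipschitz R n X (q ^~ y) (fun x => A x y) cX _ _ _ _ C s s' _ Ss Ss')).
- by move=> x Xx; exact: q_x.
- by move=> x Xx; exact: A_unit.
- by move=> x x' Xx Xx'; exact: q_inj.
- exact: cvX.
- by move=> x Xx; have [] := HC x y Xx Yy.
- by rewrite ler_wpM2r // lerDl.
Qed.

(* The derivative at [x] of [tilt y0 y1] below in the direction [e] of the
   coordinates [- D_y c(., y0)]. *)
Definition slope y0 y1 x (e : V) : R :=
  dotmx (p x y1 - p x y0) (e *m invmx (A x y0)).

Definition tilt y0 y1 x : R := - c x y1 + c x y0.

Lemma slopeD y0 y1 x e e' : slope y0 y1 x (e + e') = slope y0 y1 x e + slope y0 y1 x e'.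
Proof. by rewrite /slope mulmxDl dotmxDr. Qed.

Lemma slopeB y0 y1 x e e' : slope y0 y1 x (e - e') = slope y0 y1 x e - slope y0 y1 x e'.
Proof. by rewrite /slope mulmxBl dotmxBr. Qed.

Lemma slopeZ y0 y1 x k e : slope y0 y1 x (k *: e) = k * slope y0 y1 x e.
Proof. by rewrite /slope -scalemxAl dotmxZr. Qed.

Lemma slopeE y0 y1 x e :
  slope y0 y1 x e = dotmx ((p x y1 - p x y0) *m (invmx (A x y0))^T) e.
Proof. by rewrite /slope dotmx_mulmx trmxK. Qed.

Lemma tilt_curve y0 y1 s e t : Y y0 -> Y y1 ->
  ((q ^~ y0) @` X) s -> ((q ^~ y0) @` X) (s + e) -> 0 <= t <= 1 ->
  unit_deriv (V := R^o) (fun t => tilt y0 y1 (xexp y0 (s + t *: e))) t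
    (slope y0 y1 (xexp y0 (s + t *: e)) e).
Proof.
move=> Yy0 Yy1 Ss Se t01.
have [St dt] := xexp_curve Yy0 Ss Se t01.
have [Xt _] := xexpP St.
set w := e *m _ in dt.
have d1 := unit_deriv_dotmx (c_x Xt Yy1) dt.
have d0 := unit_deriv_dotmx (c_x Xt Yy0) dt.
move: (unit_derivD (unit_derivZ (-1) d1) d0).
set x := xexp y0 (s + t *: e) in w dt d1 d0 *.
rewrite scaleN1r !dotmxNl opprK -dotmxBl -/(slope y0 y1 x e).
congr unit_deriv; apply/funext => u.
by rewrite /tilt /= scaleN1r.
Qed.

(* Loeper's condition along the c-segment from [y0] to [y1] with respect to [x],
   whose initial speed is [slope y0 y1 x e]. *)
Lemma tilt_increasing x y0 y1 e : X x -> Y y0 -> Y y1 ->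
  ((q ^~ y0) @` X) (q x y0 + e) -> 0 < slope y0 y1 x e ->
  tilt y0 y1 x < tilt y0 y1 (xexp y0 (q x y0 + e)).
Proof.
move=> Xx Yy0 Yy1 Se sl0.
have [Xx' qx'] := xexpP Se; set x' := xexp y0 _ in Xx' qx' *.
have t01 : (0 : R) <= (0 : R) <= (1 : R) by rewrite lexx ler01.
pose yt t := yexp x (p x y0 + t *: (p x y1 - p x y0)).
have yt0 : yt 0 = y0 by rewrite /yt scale0r addr0 yexpK.
have dt0 : unit_deriv yt 0 ((p x y1 - p x y0) *m (invmx (A x y0))^T).
  by have [_ _] := yexp_curve Xx Yy0 Yy1 t01; rewrite -/(yt 0) yt0.
pose g t := - c x' (yt t) + c x (yt t).
have g0 : unit_deriv (V := R^o) g 0 (slope y0 y1 x e).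
  have c' : approx_lin (W := R^o) (fun y => c x' y) (yt 0) (dotmx (- q x' y0)).
    by rewrite yt0; exact: c_y.
  have c'' : approx_lin (W := R^o) (fun y => c x y) (yt 0) (dotmx (- q x y0)).
    by rewrite yt0; exact: c_y.
  have := unit_derivD (unit_derivZ (-1) (unit_deriv_dotmx c' dt0)) (unit_deriv_dotmx c'' dt0).
  rewrite scaleN1r !dotmxNl opprK -dotmxBl qx' [q x y0 + e]addrC addrK dotmxC -slopeE.
  by congr unit_deriv; apply/funext => u; rewrite /g /= scaleN1r.
have [d d0 Hd] := g0 (slope y0 y1 x e / 2) ltac:(by rewrite divr_gt0).
pose h := Num.min 1 (d / 2).
have h0 : 0 < h by rewrite lt_min ltr01 divr_gt0.
have h01 : 0 <= h <= 1 by rewrite ltW //= ge_min lexx.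
have hd : `|h - 0| < d.
  rewrite subr0 gtr0_norm // gt_min; apply/orP; right.
  by rewrite ltr_pdivrMr // mulr_natr mulr2n ltrDl.
have := Hd h h01 hd; rewrite subr0 (gtr0_norm h0) ler_norml => /andP [gh0' _].
have gh : (- (slope y0 y1 x e / 2 * h) <= g h - g 0 - h * slope y0 y1 x e)%R := gh0'.
have gh0 : g 0 < g h.
  have : 0 < h * slope y0 y1 x e by rewrite mulr_gt0.
  by move: gh; lra.
(* As [g 0 < g h], the maximum in Loeper's condition is not the value at [y0]; the value at [y1]
   therefore exceeds [g 0]. *)
have := loeper Xx' Xx Yy0 Yy1 h01.
rewrite /= -/(yt h) -/(g h) => gle.
have g0E : g 0 = - c x' y0 + c x y0 by rewrite /g yt0.
rewrite -g0E in gle.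
have : g 0 < - c x' y1 + c x y1.
  by move: gle; rewrite le_max => /orP [|]; [exact: lt_le_trans|rewrite leNgt gh0].
by rewrite g0E /tilt; lra.
Qed.

(** The coordinate vector [e] becomes a tangent vector at [x'], is read in the coordinates
    [q(., y)], pulled back from these to a tangent vector at [x], and read again in the coordinates
    [q(., y0)]. *)
Definition transfer x x' y0 y (e : V) : V :=
  e *m invmx (A x' y0) *m A x' y *m invmx (A x y) *m A x y0.

(* Mean value theorem along the c-segment with respect to [x]. *)
Lemma slope_transfer x x' y0 y1 e : X x -> X x' -> Y y0 -> Y y1 ->
  exists2 y, Y y & slope y0 y1 x' e = slope y0 y1 x (transfer x x' y0 y e).
Proof.
move=> Xx Xx' Yy0 Yy1.
pose yt t := yexp x (p x y0 + t *: (p x y1 - p x y0)).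
pose w := e *m invmx (A x' y0).
have Hd t : 0 <= t <= 1 -> unit_deriv (V := R^o) (fun t => dotmx (p x' (yt t)) w) t
    (slope y0 y1 x (transfer x x' y0 (yt t) e)).
  move=> t01; have [Yt pt dt] := yexp_curve Xx Yy0 Yy1 t01.
  rewrite -/(yt t) in Yt pt dt.
  have := unit_deriv_dotl w (unit_deriv_mulmx (p_y Xx' Yt) dt).
  congr unit_deriv.
  rewrite /slope /transfer mulmxK ?A_unit // -/w.
  by rewrite !dotmx_mulmx !trmxK.
have [t /andP [t0 t1]] := unit_mvt Hd (lexx 0) ltr01 (lexx 1).
have t01 : 0 <= t <= 1 by rewrite !ltW.
have yt0 : yt 0 = y0 by rewrite /yt scale0r addr0 yexpK.
have yt1 : yt 1 = y1 by rewrite /yt scale1r addrC subrK yexpK.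
rewrite yt0 yt1 subr0 mulr1 -dotmxBl -/(slope y0 y1 x' e) => E.
by exists (yt t) => //; have [] := yexp_curve Xx Yy0 Yy1 t01.
Qed.

(** With [w = e *m invmx (A x' y0)], replacing [x'] by [x] in the other Hessians turns both
    [transfer] and [e] into [w *m A x y0]; two Lipschitz errors remain. *)
Lemma transfer_close : exists2 C : R, 0 < C & forall x x' y0 y e,
  X x -> X x' -> Y y0 -> Y y ->
  `|transfer x x' y0 y e - e| <= C * `|x' - x| * `|e|.
Proof.
have [C C0 HC] := hessian_bounds.
have N0 : 0 <= n%:R :> R by [].
pose C1 := (n%:R ^+ 3 * C ^+ 2 * L + n%:R * L) * (n%:R * C) + 1.
exists C1.
  by rewrite ltr_wpDl // !mulr_ge0 ?(ltW C0) // addr_ge0 // !mulr_ge0 ?exprn_ge0 // ltW.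
move=> x x' y0 y e Xx Xx' Yy0 Yy.
have lip z : Y z -> `|A x' z - A x z| <= L * `|x' - x|.
  by move=> Yz; apply: (le_trans (A_lip _ _ _ _)) => //; rewrite subrr normr0 addr0.
pose w := e *m invmx (A x' y0).
have we : `|w| <= n%:R * C * `|e|.
  apply: (le_trans (mx_norm_mulmx _ _)); rewrite mulrAC ler_wpM2r // ler_wpM2l //.
  by have [] := HC x' y0 Xx' Yy0.
have E1 : w *m A x y *m (invmx (A x y) *m A x y0) = w *m A x y0.
  by rewrite mulmxA mulmxK ?A_unit.
have E2 : w *m A x' y0 = e by rewrite /w mulmxKV ?A_unit.
have -> : transfer x x' y0 y e - e =
    w *m (A x' y - A x y) *m (invmx (A x y) *m A x y0) - w *m (A x' y0 - A x y0).
  rewrite /transfer -/w [w *m (A x' y - _)]mulmxBr mulmxBl E1 mulmxBr E2.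
  by rewrite opprB addrA subrK !mulmxA.
apply: (le_trans (ler_normB _ _)).
have b1 : `|w *m (A x' y - A x y) *m (invmx (A x y) *m A x y0)| <=
    n%:R ^+ 2 * (`|w| * (L * `|x' - x|) * (n%:R * C * C)).
  apply: (le_trans (mulmx_norm3 _ _ _)); rewrite ler_wpM2l ?exprn_ge0 //.
  rewrite ler_pM ?mulr_ge0 // ?ler_wpM2l ?lip //.
  apply: (le_trans (mx_norm_mulmx _ _)); rewrite ler_pM ?mulr_ge0 // ?ler_wpM2l //.
  - by have [] := HC x y Xx Yy.
  - by have [] := HC x y0 Xx Yy0.
have b2 : `|w *m (A x' y0 - A x y0)| <= n%:R * `|w| * (L * `|x' - x|).
  by apply: (le_trans (mx_norm_mulmx _ _)); rewrite ler_wpM2l ?mulr_ge0 ?lip.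
apply: (le_trans (lerD b1 b2)).
rewrite [leLHS](_ : _ = (n%:R ^+ 3 * C ^+ 2 * L + n%:R * L) * `|x' - x| * `|w|); last by ring.
have k0 : 0 <= (n%:R ^+ 3 * C ^+ 2 * L + n%:R * L) * `|x' - x|.
  by rewrite mulr_ge0 // addr_ge0 // !mulr_ge0 ?exprn_ge0 // ltW.
apply: (le_trans (ler_wpM2l k0 we)).
rewrite /C1 [leLHS](_ : _ = (n%:R ^+ 3 * C ^+ 2 * L + n%:R * L) * (n%:R * C) * `|x' - x| * `|e|); last by ring.
by rewrite ler_wpM2r // ler_wpM2r // lerDl.
Qed.

(** * Tangent spaces of the sets [q(X, y)] *)

Lemma tangent_transfer x y y' e m (M : 'M[R]_(m, n)) : X x -> Y y -> Y y' ->
  ((q ^~ y) @` X) (q x y + e) -> directions ((q ^~ y') @` X) M ->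
  (e *m invmx (A x y) *m A x y' <= M)%MS.
Proof.
move=> Xx Yy Yy' Se dM.
have Ss : ((q ^~ y) @` X) (q x y) by exists x.
have t01 : (0 : R) <= (0 : R) <= (1 : R) by rewrite lexx ler01.
pose xt t := xexp y (q x y + t *: e).
have xt0 : xt 0 = x by rewrite /xt scale0r addr0 xexpK.
have [_ ] := xexp_curve Yy Ss Se t01; rewrite -/(xt 0) xt0 => dt.
have qx' : approx_lin (q ^~ y') (xt 0) (fun w => w *m A x y') by rewrite xt0; exact: q_x.
apply: (unit_deriv_submx (unit_deriv_mulmx qx' dt)) => h h01.
have [Sh _] := xexp_curve Yy Ss Se h01; have [Xh _] := xexpP Sh.
by apply: dM => /=; [exists (xt h) | exists (xt 0); rewrite ?xt0].
Qed.

Lemma room_transfer x y y' m (M : 'M[R]_(m, n)) m' (M' : 'M[R]_(m', n)) r :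
  X x -> Y y -> Y y' -> 0 < r -> room ((q ^~ y) @` X) M r (q x y) ->
  directions ((q ^~ y') @` X) M' ->
  (M *m (invmx (A x y) *m A x y') <= M')%MS.
Proof.
move=> Xx Yy Yy' r0 rM dM'; apply/row_subP => i; rewrite row_mul.
(* Room at [q x y] makes a small multiple of each row of [M] a displacement inside [q(X, y)], to
   which [tangent_transfer] applies. *)
pose k := r / (`|row i M| + 1).
have d0 : 0 < `|row i M| + 1 by rewrite ltr_wpDl.
have k0 : 0 < k by rewrite divr_gt0.
have Sk : ((q ^~ y) @` X) (q x y + k *: row i M).
  apply: rM; first by rewrite scalemx_sub // row_sub.
  rewrite normrZ gtr0_norm // /k mulrAC ler_pdivrMr // ler_wpM2l ?(ltW r0) //.
  by rewrite lerDl.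
have := tangent_transfer Xx Yy Yy' Sk dM'.
rewrite -!scalemxAl mulmxA => /(scalemx_sub k^-1).
by rewrite scalerA mulVf ?gt_eqF // scale1r.
Qed.

(* The converse of [room_transfer] holds because both spans have the same rank. *)
Lemma room_transfer_eq x y y' m (M : 'M[R]_(m, n)) m' (M' : 'M[R]_(m', n)) r z' r' :
  X x -> Y y -> Y y' -> 0 < r -> room ((q ^~ y) @` X) M r (q x y) ->
  directions ((q ^~ y) @` X) M ->
  directions ((q ^~ y') @` X) M' ->
  0 < r' -> room ((q ^~ y') @` X) M' r' z' ->
  (M' <= M *m (invmx (A x y) *m A x y'))%MS.
Proof.
move=> Xx Yy Yy' r0 rM dM dM' r0' rM'.
have Ty := room_transfer Xx Yy Yy' r0 rM dM'.
have [x' Xx' qz'] := room_mem (ltW r0') rM'.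
have Ty' : (M' *m (invmx (A x' y') *m A x' y) <= M)%MS.
  by apply: (room_transfer Xx' Yy' Yy r0' _ dM) => /=; rewrite qz'.
have free x1 y1 y2 : X x1 -> Y y1 -> Y y2 -> row_free (invmx (A x1 y1) *m A x1 y2).
  by move=> *; rewrite row_free_unit unitmx_mul unitmx_inv !A_unit.
have := mxrank_leqif_eq Ty; case=> _ E.
suff /andP [] : (M *m (invmx (A x y) *m A x y') == M')%MS by [].
rewrite -E eqn_leq mxrankS //= (mxrankMfree M (free _ _ _ Xx Yy Yy')).
by rewrite -(mxrankMfree M' (free _ _ _ Xx' Yy' Yy)) mxrankS.
Qed.

(** The span of [q(X, y)] is the intermediate space: the step at [x'] maps [M] into it, and the step
    at [x] maps it back into [M] by equality of ranks. *)
Lemma transfer_submx x x' y0 y e m (M : 'M[R]_(m, n)) r r' :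
  X x -> X x' -> Y y0 -> Y y -> directions ((q ^~ y0) @` X) M ->
  0 < r -> room ((q ^~ y0) @` X) M r (q x y0) ->
  0 < r' -> room ((q ^~ y0) @` X) M r' (q x' y0) ->
  (e <= M)%MS -> (transfer x x' y0 y e <= M)%MS.
Proof.
move=> Xx Xx' Yy0 Yy dM r0 rx r0' rx' eM.
have Sy : ((q ^~ y) @` X) (q x y) by exists x.
have [m1 [M1 [dM1 [z [r1 r10 rz]]]]] := relative_interior_exists (cvX Yy) Sy.
have T1 := room_transfer Xx' Yy0 Yy r0' rx' dM1.
have T2 := room_transfer_eq Xx Yy0 Yy r0 rx dM dM1 r10 rz.
have : (e *m (invmx (A x' y0) *m A x' y) <= M *m (invmx (A x y0) *m A x y))%MS.
  by apply: submx_trans T2; apply: submx_trans T1; exact: submxMr.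
move=> /(submxMr (invmx (A x y) *m A x y0)).
rewrite /transfer !mulmxA mulmxK ?A_unit // mulmxKV ?A_unit //.
Qed.

(** * Second-order lower bounds along c*-segments *)

Lemma tilt_mean_value : exists2 K : R, 0 < K &
  forall x y0 y1 m (M : 'M[R]_(m, n)) r nu u f,
  X x -> Y y0 -> Y y1 -> directions ((q ^~ y0) @` X) M ->
  room ((q ^~ y0) @` X) M r (q x y0) ->
  (forall w, (w <= M)%MS -> `|slope y0 y1 x w| <= 2 * nu * `|w|) ->
  0 <= nu -> (u <= M)%MS -> (f <= M)%MS -> `|u| + `|f| < r ->
  `|tilt y0 y1 (xexp y0 (q x y0 + u + f)) - tilt y0 y1 (xexp y0 (q x y0 + u))
    - slope y0 y1 x f| <= 2 * nu * (K * (`|u| + `|f|) * `|f|).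
Proof.
have [C1 C10 HC1] := transfer_close; have [C2 C20 HC2] := xexp_lipschitz.
exists (C1 * C2); first exact: mulr_gt0.
move=> x y0 y1 m M r nu u f Xx Yy0 Yy1 dM rx nuM nu0 uM fM ufr.
have r0 : 0 < r by apply: le_lt_trans ufr; exact: addr_ge0.
have Ss : ((q ^~ y0) @` X) (q x y0) by exists x.
have roomt t : 0 <= t <= 1 ->
    room ((q ^~ y0) @` X) M (r - (`|u| + `|f|)) (q x y0 + u + t *: f).
  move=> /andP [t0 t1]; rewrite -addrA; apply: room_shift => //.
    by rewrite addmx_sub // scalemx_sub.
  rewrite (le_trans (ler_normD _ _)) // lerD2l normrZ ger0_norm //.
  by rewrite ler_piMl.
have r'0 : 0 < r - (`|u| + `|f|) by rewrite subr_gt0.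
have memt t : 0 <= t <= 1 -> ((q ^~ y0) @` X) (q x y0 + u + t *: f).
  by move=> t01; exact: room_mem (ltW r'0) (roomt t t01).
have S0 : ((q ^~ y0) @` X) (q x y0 + u).
  by have := memt 0; rewrite scale0r addr0 lexx ler01 => /(_ isT).
have S1 : ((q ^~ y0) @` X) (q x y0 + u + f).
  by have := memt 1; rewrite scale1r lexx ler01 => /(_ isT).
have [t /andP [t0 t1]] := unit_mvt (fun t t01 => tilt_curve Yy0 Yy1 S0 S1 t01)
  (lexx 0) ltr01 (lexx 1).
rewrite scale1r scale0r addr0 subr0 mulr1 => ->.
have t01 : 0 <= t <= 1 by rewrite !ltW.
have St := memt t t01; have [Xt qt] := xexpP St.
set xt := xexp y0 _ in Xt qt *.
(* The slope at the intermediate point becomes a slope at [x], so that the bound [2 * nu] applies to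
   the difference between the transferred vector and [f], which is small and lies in the span. *)
have [y Yy ->] := slope_transfer f Xx Xt Yy0 Yy1.
have trM : (transfer x xt y0 y f <= M)%MS.
  by apply: (transfer_submx Xx Xt Yy0 Yy dM r0 rx r'0) => //; rewrite qt; exact: roomt.
rewrite -slopeB (le_trans (nuM _ _)) ?addmx_sub ?eqmx_opp //.
rewrite ler_wpM2l ?mulr_ge0 // (le_trans (HC1 _ _ _ _ _ Xx Xt Yy0 Yy)) //.
rewrite ler_wpM2r // -mulrA ler_wpM2l ?(ltW C10) //.
rewrite -[x](xexpK Xx Yy0) (le_trans (HC2 _ _ _ Yy0 _ _)) // ler_wpM2l ?(ltW C20) //.
rewrite -[q x y0 + u + _]addrA [_ - q x y0]addrC addKr (le_trans (ler_normD _ _)) // lerD2l.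
by rewrite normrZ ger0_norm ?(ltW t0) // ler_piMl // ltW.
Qed.

(* Only the coordinate directions annihilated by the slope are controlled by Loeper's
   condition; a general direction [e] is moved to such a direction along [d],
   on which the slope is almost maximal, so that the error is proportional to
   the slope of [e] itself. *)
Lemma tilt_second_order : exists2 K : R, 0 < K &
  forall x y0 y1 m (M : 'M[R]_(m, n)) r e,
  X x -> Y y0 -> Y y1 -> directions ((q ^~ y0) @` X) M ->
  0 < r -> room ((q ^~ y0) @` X) M r (q x y0) ->
  (e <= M)%MS -> 8 * `|e| <= r ->
  tilt y0 y1 x + slope y0 y1 x e - K * `|e| * `|slope y0 y1 x e| <=
  tilt y0 y1 (xexp y0 (q x y0 + e)).
Proof.
have [K K0 HK] := tilt_mean_value.
(* [10 = 2 * 5]: the 2 comes with [nu], and [|e0| + |f| <= 5 * |e|] below. *)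
exists (10 * K); first by rewrite mulr_gt0.
move=> x y0 y1 m M r e Xx Yy0 Yy1 dM r0 rx eM er.
have [d [dM' d1 nuM0]] :=
  near_norming_direction ((p x y1 - p x y0) *m (invmx (A x y0))^T) M.
have nuM w : (w <= M)%MS -> `|slope y0 y1 x w| <= 2 * slope y0 y1 x d * `|w|.
  by move=> wM; rewrite !slopeE nuM0.
set nu := slope y0 y1 x d in nuM.
have nu0 : 0 <= nu.
  rewrite leNgt; apply/negP => nun.
  have : 0 < `|nu| by rewrite normr_gt0 lt_eqF.
  have := nuM d dM'; rewrite -/nu.
  have : 2 * nu * `|d| <= 0 by rewrite mulr_le0_ge0 // mulr_ge0_le0 // ltW.
  by lra.
have := nuM e eM; set a := slope y0 y1 x e => ae.
(* If [nu = 0], the slope vanishes on the whole span and the mean value estimate gives [tilt] equal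
   values at both ends. *)
have [nuE|nun0] := eqVneq nu 0.
  move: ae; rewrite nuE mulr0 mul0r normr_le0 => /eqP aE.
  have := HK x y0 y1 m M r nu 0 e Xx Yy0 Yy1 dM rx nuM nu0 (sub0mx _ _) eM.
  rewrite addr0 xexpK // normr0 add0r -/a aE nuE mulr0 mul0r subr0 normr0.
  have -> : `|e| < r by have := normr_ge0 e; lra.
  by move=> /(_ isT); rewrite normr_le0 subr_eq0 => /eqP ->; rewrite mulr0 addr0 subr0.
have nup : 0 < nu by rewrite lt_def nun0.
pose k := a / nu.
have kb : `|k| <= 2 * `|e|.
  by rewrite normrM normfV (gtr0_norm nup) ler_pdivrMr // mulrAC.
pose f := k *: d; pose e0 := e - f.
have fk : `|f| <= `|k| by rewrite normrZ ler_piMr.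
have fM : (f <= M)%MS by rewrite scalemx_sub.
have e0M : (e0 <= M)%MS by rewrite /e0 -scaleN1r addmx_sub // scalemx_sub.
have e0b : `|e0| <= 3 * `|e|.
  by rewrite (le_trans (ler_normB _ _)) //; lra.
have en := normr_ge0 e.
have slf : slope y0 y1 x f = a by rewrite slopeZ -/nu divfK.
have sle0 : slope y0 y1 x e0 = 0 by rewrite slopeB slf subrr.
pose g t := tilt y0 y1 (xexp y0 (q x y0 + e0 + t *: ((r / 2) *: d))).
have bt t : 0 <= t <= 1 -> `|e0 + t *: ((r / 2) *: d)| <= r.
  move=> /andP [t0 t1]; rewrite (le_trans (ler_normD _ _)) //.
  have : `|t *: ((r / 2) *: d)| <= r / 2.
    rewrite normrZ normrZ (ger0_norm t0) [`|r / 2|]gtr0_norm ?divr_gt0 //.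
    rewrite mulrCA -[leRHS]mulr1 ler_wpM2l ?divr_ge0 ?(ltW r0) //.
    by rewrite mulr_ile1.
  by lra.
have mt t : 0 <= t <= 1 -> ((q ^~ y0) @` X) (q x y0 + e0 + t *: ((r / 2) *: d)).
  move=> t01; rewrite -addrA; apply: rx (bt t t01).
  by rewrite addmx_sub // !scalemx_sub.
have z01 : (0 : R) <= (0 : R) <= (1 : R) by rewrite lexx ler01.
have o01 : (0 : R) <= (1 : R) <= (1 : R) by rewrite lexx ler01.
(* Loeper's condition needs a positive slope: [e0] is pushed by a small multiple of [d], whose slope
   is [nu > 0], and the push is sent to zero. *)
have g0 : tilt y0 y1 x <= tilt y0 y1 (xexp y0 (q x y0 + e0)).
  have S0 := mt 0 z01; have S1 := mt 1 o01.
  rewrite scale0r addr0 in S0; rewrite scale1r in S1.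
  have dg := tilt_curve Yy0 Yy1 S0 S1 z01; rewrite -/g in dg.
  apply/ler_addgt0Pr => eps eps0.
  have [del del0 Hdel] := unit_deriv_cont dg eps0.
  pose h := Num.min 1 (del / 2).
  have h0 : 0 < h by rewrite lt_min ltr01 divr_gt0.
  have h01 : 0 <= h <= 1 by rewrite ltW //= ge_min lexx.
  have hd : `|h - 0| < del.
    rewrite subr0 gtr0_norm // gt_min; apply/orP; right.
    by rewrite ltr_pdivrMr // mulr_natr mulr2n ltrDl.
  have g00 : g 0 = tilt y0 y1 (xexp y0 (q x y0 + e0)) by rewrite /g scale0r addr0.
  have := Hdel h h01 hd; rewrite g00 ltr_norml => /andP [_].
  have : tilt y0 y1 x < tilt y0 y1 (xexp y0 (q x y0 + (e0 + h *: ((r / 2) *: d)))).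
    apply: tilt_increasing => //; first by rewrite addrA; exact: mt.
    by rewrite slopeD sle0 add0r !slopeZ !mulr_gt0 // divr_gt0.
  by rewrite addrA -/(g h); lra.
have ufr : `|e0| + `|f| < r by lra.
have := HK x y0 y1 m M r nu e0 f Xx Yy0 Yy1 dM rx nuM nu0 e0M fM ufr.
have -> : q x y0 + e0 + f = q x y0 + e by rewrite -addrA /e0 subrK.
rewrite slf.
have : 2 * nu * (K * (`|e0| + `|f|) * `|f|) <= 10 * K * `|e| * `|a|.
  rewrite [leLHS](_ : _ = 2 * K * (`|e0| + `|f|) * (nu * `|f|)); last by ring.
  rewrite [leRHS](_ : _ = 2 * K * (5 * `|e|) * `|a|); last by ring.
  apply: ler_pM; rewrite ?mulr_ge0 ?addr_ge0 // ?(ltW K0) //.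
    by rewrite ler_wpM2l ?mulr_ge0 ?(ltW K0) //; lra.
  apply: (le_trans (ler_wpM2l nu0 fk)).
  by rewrite normrM normfV (gtr0_norm nup) mulrCA divff ?mulr1 // gt_eqF.
by move=> h1 /ler_normlP [+ _]; lra.
Qed.

Lemma slope_segment : exists2 K : R, 0 < K &
  forall x y0 y1 m (M : 'M[R]_(m, n)) r e t,
  X x -> Y y0 -> Y y1 -> directions ((q ^~ y0) @` X) M -> 0 < r ->
  room ((q ^~ y0) @` X) M r (q x y0) ->
  room ((q ^~ y0) @` X) M r (q x y0 + e) ->
  (e <= M)%MS -> 0 < slope y0 y1 x e -> 0 <= t <= 1 -> K * `|e| * t <= 1 / 2 ->
  slope y0 y1 x e / 2 <= slope y0 y1 (xexp y0 (q x y0 + t *: e)) e.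
Proof.
have [K K0 HK] := tilt_second_order.
exists (2 * K); first by rewrite mulr_gt0.
move=> x y0 y1 m M r e t Xx Yy0 Yy1 dM r0 rx rxe eM sl0 t01 Ket.
have /andP [t0 t1] := t01.
have [->|tn0] := eqVneq t 0.
  by rewrite scale0r addr0 xexpK //; lra.
have tp : 0 < t by rewrite lt_def tn0.
have en := normr_ge0 e.
(* Steps of length [t / N] meet the requirement [8 * |h *: e| <= r] of [tilt_second_order]. [N]
   depends on [r], the bound accumulated over all steps does not. *)
pose N := (Num.truncn (8 * `|e| / r)).+1.
have Nr : 8 * `|e| < N%:R * r.
  by rewrite -ltr_pdivrMr // truncnS_gt.
have Np : 0 < N%:R :> R by rewrite ltr0n.
pose h := t / N%:R.
have h0 : 0 < h by rewrite divr_gt0.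
have hN : h * N%:R = t by rewrite /h divfK // gt_eqF.
have her : 8 * (h * `|e|) <= r.
  rewrite -(ler_pM2r Np) [leLHS](_ : _ = (h * N%:R) * (8 * `|e|)); last by ring.
  rewrite hN; apply: (@le_trans _ _ (8 * `|e|)); first by rewrite ler_piMl // mulr_ge0.
  by rewrite [r * _]mulrC ltW.
have hj01 j : (j <= N)%N -> 0 <= h * j%:R <= 1 /\ h * j%:R <= t.
  move=> jN; have hjt : h * j%:R <= t by rewrite -hN ler_wpM2l ?(ltW h0) // ler_nat.
  by split => //; rewrite mulr_ge0 ?(ltW h0) //= (le_trans hjt).
have roomt u : 0 <= u <= 1 -> room ((q ^~ y0) @` X) M r (q x y0 + u *: e).
  move=> u01; have := room_comb (cvX Yy0) u01 rx rxe; congr room.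
  by rewrite scalerBl scale1r scalerDr addrA subrK.
pose xt u := xexp y0 (q x y0 + u *: e).
have xtP u : 0 <= u <= 1 -> X (xt u) /\ q (xt u) y0 = q x y0 + u *: e.
  by move=> u01; apply: xexpP; exact: room_mem (ltW r0) (roomt u u01).
(* Each step costs at most [2 * K * |e| * h] of the initial slope, in total
   [2 * K * |e| * t <= 1 / 2]. *)
suff main j : (j <= N)%N ->
    (1 - 2 * K * `|e| * (h * j%:R)) * slope y0 y1 x e <= slope y0 y1 (xt (h * j%:R)) e.
  have := main N (leqnn N); rewrite hN; apply: le_trans.
  by rewrite [leLHS]mulrC ler_pM2r //; lra.
elim: j => [_|j IH jN].
  by rewrite mulr0 mulr0 subr0 mul1r /xt scale0r addr0 xexpK.
have {}IH := IH (ltnW jN).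
have [jh01 jht] := hj01 j (ltnW jN); have [j1h01 j1ht] := hj01 j.+1 jN.
have [Xj qj] := xtP _ jh01; have [Xj1 qj1] := xtP _ j1h01.
have KE := mulr_ge0 (ltW K0) en.
have hjK : 2 * K * `|e| * (h * j.+1%:R) <= 1 / 2.
  by apply: le_trans Ket; rewrite ler_wpM2l // -mulrA mulr_ge0.
have jS : h * j.+1%:R = h * j%:R + h by rewrite -natr1 mulrDr mulr1.
rewrite jS in hjK qj1 Xj1 *.
set u := h * j%:R in IH jh01 jht Xj qj qj1 Xj1 hjK *.
have /andP [u0 _] := jh01.
set a0 := slope y0 y1 x e in sl0 IH *.
set a := slope y0 y1 (xt u) e in IH.
set b := slope y0 y1 (xt (u + h)) e.
set k := K * `|e| in KE *.
have kh : 0 <= k * h by rewrite mulr_ge0 // ltW.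
have ku : 0 <= k * u by rewrite mulr_ge0.
have hjK' : 2 * (k * u) + 2 * (k * h) <= 1 / 2.
  by move: hjK; rewrite -[2 * K * _]mulrA -/k mulrDr !mulrA.
have IH' : (1 - 2 * (k * u)) * a0 <= a.
  by move: IH; rewrite -[2 * K * _]mulrA -/k !mulrA.
have ap : 0 < a.
  by clear -IH' sl0 ku kh hjK'; apply: lt_le_trans IH'; rewrite mulr_gt0 //; lra.
have heM : (h *: e <= M)%MS by rewrite scalemx_sub.
have NheM : (- h *: e <= M)%MS by rewrite scalemx_sub.
have nhe : `|h *: e| = h * `|e| by rewrite normrZ gtr0_norm.
have nNhe : `|- h *: e| = h * `|e| by rewrite normrZ normrN gtr0_norm.
(* [T1] looks forward from [xt u], [T2] backward from [xt (u + h)]; in their sum the values of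
   [tilt] cancel and only the two slopes are left. *)
have T1 : tilt y0 y1 (xt u) + h * a - K * (h * `|e|) * (h * a) <= tilt y0 y1 (xt (u + h)).
  have := HK (xt u) y0 y1 m M r (h *: e) Xj Yy0 Yy1 dM r0.
  rewrite qj => /(_ (roomt u jh01) heM); rewrite nhe => /(_ her).
  have -> : q x y0 + u *: e + h *: e = q x y0 + (u + h) *: e.
    by rewrite -addrA -scalerDl.
  by rewrite slopeZ -/a -/(xt (u + h)) (gtr0_norm (mulr_gt0 h0 ap)).
have T2 : tilt y0 y1 (xt (u + h)) - h * b - K * (h * `|e|) * (h * `|b|) <= tilt y0 y1 (xt u).
  have := HK (xt (u + h)) y0 y1 m M r (- h *: e) Xj1 Yy0 Yy1 dM r0.
  rewrite qj1 => /(_ (roomt _ _) NheM); rewrite nNhe -jS => /(_ j1h01 her).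
  rewrite jS -/u; have -> : q x y0 + (u + h) *: e + - h *: e = q x y0 + u *: e.
    by rewrite -addrA -scalerDl addrK.
  rewrite slopeZ -/b -/(xt u) mulNr normrN normrM.
  by rewrite (gtr0_norm h0).
have T3 : a - k * h * a <= b + k * h * `|b|.
  rewrite -(ler_pM2l h0).
  have e1 : h * (a - k * h * a) = h * a - K * (h * `|e|) * (h * a) by rewrite /k; ring.
  have e2 : h * (b + k * h * `|b|) = h * b + K * (h * `|e|) * (h * `|b|) by rewrite /k; ring.
  by rewrite e1 e2; lra.
rewrite -[2 * K * _]mulrA -/k [2 * k * _](_ : _ = 2 * (k * u) + 2 * (k * h)); last by ring.
exact: (one_step_decay ku kh hjK' sl0 IH' T3).
Qed.

(** For one fixed [yb] compactness of [X] bounds [q(., yb)]; for any other [y] the difference is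
    estimated along the c*-segment with respect to [yb], using the Hessian bounds. *)
Lemma coordinates_bounded : exists2 D : R, 0 < D &
  forall x x' y, X x -> X x' -> Y y -> `|q x' y - q x y| <= D.
Proof.
have [[yb Yyb]|noY] := pselect (exists yb, Y yb); last first.
  by exists 1 => // x x' y _ _ Yy; exfalso; apply: noY; exists y.
have [C C0 HC] := hessian_bounds.
have [|E E0 HE] := @compact_locally_bounded R V X (fun x => `|q x yb|) cX.
  move=> x Xx.
  have [|d d0 Hd] := @approx_lin_cont R n V (q ^~ yb) x (fun w => w *m A x yb)
     (n%:R * `|A x yb|) (q_x Xx Yyb) _ 1 ltr01.
    by move=> h; rewrite mulrAC; exact: mx_norm_mulmx.
  exists d => //; exists (`|q x yb| + 1) => x' Xx' /Hd h.
  rewrite -[q x' yb](subrK (q x yb)) addrC (le_trans (ler_normD _ _)) // lerD2l.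
  exact: ltW.
pose D := n%:R ^+ 2 * ((E + E) * C * C).
have D0 : 0 <= D by rewrite /D !mulr_ge0 ?exprn_ge0 ?addr_ge0 // ltW.
exists (D + 1); first by rewrite ltr_wpDl.
move=> x x' y Xx Xx' Yy; rewrite (@le_trans _ _ D) ?lerDl //.
pose e := q x' yb - q x yb.
have Ss : ((q ^~ yb) @` X) (q x yb) by exists x.
have Se : ((q ^~ yb) @` X) (q x yb + e) by exists x' => //; rewrite addrC subrK.
pose xt t := xexp yb (q x yb + t *: e).
have xt0 : xt 0 = x by rewrite /xt scale0r addr0 xexpK.
have xt1 : xt 1 = x' by rewrite /xt scale1r addrC subrK xexpK.
have := @unit_mean_value R n (fun t => q (xt t) y)
  (fun t => e *m invmx (A (xt t) yb) *m A (xt t) y) D D0.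
rewrite xt0 xt1; apply => t t01.
  have [St dt] := xexp_curve Yyb Ss Se t01; have [Xt _] := xexpP St.
  exact: (unit_deriv_mulmx (q_x Xt Yy) dt).
have [St _] := xexp_curve Yyb Ss Se t01; have [Xt _] := xexpP St.
apply: (le_trans (mulmx_norm3 _ _ _)); rewrite ler_wpM2l ?exprn_ge0 //.
have [A1 _] := HC _ _ Xt Yy; have [_ A2] := HC _ _ Xt Yyb.
rewrite ler_pM ?mulr_ge0 // ler_pM //.
by rewrite (le_trans (ler_normB _ _)) // lerD // HE.
Qed.

(** On the initial piece [[0, rho]] the slope keeps half its value, which gives the linear gain;
    from [rho] to 1 [tilt_increasing] prevents any loss. *)
Lemma tilt_lower_bound_room : exists2 k : R, 0 < k &
  forall x y0 y1 m (M : 'M[R]_(m, n)) r e,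
  X x -> Y y0 -> Y y1 -> directions ((q ^~ y0) @` X) M -> 0 < r ->
  room ((q ^~ y0) @` X) M r (q x y0) ->
  room ((q ^~ y0) @` X) M r (q x y0 + e) ->
  0 < slope y0 y1 x e ->
  k * slope y0 y1 x e <= tilt y0 y1 (xexp y0 (q x y0 + e)) - tilt y0 y1 x.
Proof.
have [K K0 HK] := slope_segment; have [D D0 HD] := coordinates_bounded.
have KD := mulr_gt0 K0 D0.
(* Chosen so that [K * D * rho <= 1 / 2] and [rho < 1]. *)
pose rho := (2 * (K * D) + 2)^-1.
have den0 : 0 < 2 * (K * D) + 2 by rewrite addr_gt0 // mulr_gt0.
have rho0 : 0 < rho by rewrite invr_gt0.
have rhoE : rho * (2 * (K * D) + 2) = 1 by rewrite mulVf // gt_eqF.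
have rho1 : rho < 1 by have := mulr_gt0 rho0 KD; lra.
exists (rho / 2); first by rewrite divr_gt0.
move=> x y0 y1 m M r e Xx Yy0 Yy1 dM r0 rx rxe sl0.
have Ss := room_mem (ltW r0) rx; have Se := room_mem (ltW r0) rxe.
have eM : (e <= M)%MS by have := dM _ _ Se Ss; rewrite addrC addKr.
have [Xe qe] := xexpP Se.
have eD : `|e| <= D by have := HD _ _ _ Xx Xe Yy0; rewrite qe addrC addKr.
have lowt t : 0 <= t <= rho ->
    slope y0 y1 x e / 2 <= slope y0 y1 (xexp y0 (q x y0 + t *: e)) e.
  move=> /andP [t0 t1]; apply: (HK x y0 y1 m M r e t Xx Yy0 Yy1 dM r0 rx rxe eM sl0).
    by rewrite t0 (le_trans t1) // ltW.
  apply: (@le_trans _ _ (K * D * rho)).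
    by rewrite ler_pM ?mulr_ge0 ?(ltW K0) // ler_wpM2l ?(ltW K0).
  by have := rho0; lra.
pose xt t := xexp y0 (q x y0 + t *: e).
have xt0 : xt 0 = x by rewrite /xt scale0r addr0 xexpK.
have r01 : 0 <= rho <= 1 by rewrite !ltW.
have [t /andP [t0 t1]] := unit_mvt (fun t t01 => tilt_curve Yy0 Yy1 Ss Se t01)
  (lexx 0) rho0 (ltW rho1).
rewrite -/(xt rho) -/(xt 0) -/(xt t) xt0 subr0 => tE.
have slt : slope y0 y1 x e / 2 <= slope y0 y1 (xt t) e by apply: lowt; rewrite !ltW.
have slr : slope y0 y1 x e / 2 <= slope y0 y1 (xt rho) e by apply: lowt; rewrite lexx ltW.
have [Sr _] := xexp_curve Yy0 Ss Se r01; have [Xr qr] := xexpP Sr.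
rewrite -/(xt rho) in Xr qr.
have qr1 : q (xt rho) y0 + (1 - rho) *: e = q x y0 + e.
  by rewrite qr -addrA -scalerDl [rho + _]addrC subrK scale1r.
have : tilt y0 y1 (xt rho) < tilt y0 y1 (xexp y0 (q x y0 + e)).
  rewrite -qr1; apply: tilt_increasing => //; first by rewrite qr1.
  by rewrite slopeZ mulr_gt0 ?subr_gt0 //; lra.
have : slope y0 y1 x e / 2 * rho <= slope y0 y1 (xt t) e * rho by rewrite ler_wpM2r // ltW.
by lra.
Qed.

(** * Passage to boundary points, and the final estimate *)

Lemma slope_continuous x y0 y1 e : X x -> Y y0 -> Y y1 ->
  exists2 C : R, 0 < C & forall x', X x' ->
    `|slope y0 y1 x' e - slope y0 y1 x e| <= C * `|x' - x|.
Proof.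
move=> Xx Yy0 Yy1; have [C1 C10 HC1] := transfer_close.
set a := (p x y1 - p x y0) *m (invmx (A x y0))^T.
exists (n%:R * `|a| * C1 * `|e| + 1).
  by rewrite ltr_wpDl // !mulr_ge0 // ltW.
move=> x' Xx'; have [y Yy ->] := slope_transfer e Xx Xx' Yy0 Yy1.
rewrite -slopeB slopeE (le_trans (dotmx_norm _ _)) //.
rewrite (le_trans (ler_wpM2l _ (HC1 _ _ _ _ _ Xx Xx' Yy0 Yy))) ?mulr_ge0 //.
rewrite [leLHS](_ : _ = n%:R * `|a| * C1 * `|e| * `|x' - x|); last by rewrite -/a; ring.
by rewrite ler_wpM2r // lerDl.
Qed.

(** Both [x] and [x'] are moved by the same fraction [t] towards a relative interior point [z]. This
    creates room [t * r] and only scales [e] by [1 - t]; as [k] does not depend on the room, [t] can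
    tend to zero. *)
Lemma tilt_lower_bound : exists2 k : R, 0 < k &
  forall x x' y0 y1, X x -> X x' -> Y y0 -> Y y1 ->
  0 < slope y0 y1 x (q x' y0 - q x y0) ->
  k * slope y0 y1 x (q x' y0 - q x y0) <= tilt y0 y1 x' - tilt y0 y1 x.
Proof.
have [k k0 Hk] := tilt_lower_bound_room; have [C2 C20 HC2] := xexp_lipschitz.
exists k => // x x' y0 y1 Xx Xx' Yy0 Yy1.
set e := q x' y0 - q x y0; set al := slope y0 y1 x e => al0.
have Ss : ((q ^~ y0) @` X) (q x y0) by exists x.
have Ss' : ((q ^~ y0) @` X) (q x' y0) by exists x'.
have [m [M [dM [z [r r0 rz]]]]] := relative_interior_exists (cvX Yy0) Ss.
have Sz := room_mem (ltW r0) rz.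
have [C3 C30 HC3] := slope_continuous e Xx Yy0 Yy1.
have z01 : (0 : R) <= (0 : R) <= (1 : R) by rewrite lexx ler01.
have Sz1 : ((q ^~ y0) @` X) (q x y0 + (z - q x y0)) by rewrite addrC subrK.
have Sz1' : ((q ^~ y0) @` X) (q x' y0 + (z - q x' y0)) by rewrite addrC subrK.
pose xt t := xexp y0 (q x y0 + t *: (z - q x y0)).
pose xt' t := xexp y0 (q x' y0 + t *: (z - q x' y0)).
have xt0 : xt 0 = x by rewrite /xt scale0r addr0 xexpK.
have xt0' : xt' 0 = x' by rewrite /xt' scale0r addr0 xexpK.
have dx := tilt_curve Yy0 Yy1 Ss Sz1 z01.
have dx' := tilt_curve Yy0 Yy1 Ss' Sz1' z01.
(* The total error is at most [(2 + k + k * al) * eps]: one [eps] for each end of [tilt], the rest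
   for the slope. *)
pose B := 3 + k + k * al.
have B0 : 0 < B by rewrite !addr_gt0 // mulr_gt0.
apply/ler_addgt0Pr => eps' eps'0.
pose eps := Num.min (eps' / B) (Num.min (al / 2) 1).
have eps0 : 0 < eps by rewrite !lt_min !divr_gt0 // ltr01.
have epsal : eps <= al / 2 by rewrite !ge_min lexx orbT.
have epsB : eps * B <= eps' by rewrite -ler_pdivlMr // !ge_min lexx.
have [d1 d10 H1] := unit_deriv_cont dx eps0.
have [d2 d20 H2] := unit_deriv_cont dx' eps0.
pose w := C3 * (C2 * (`|z - q x y0| + 1)).
have w0 : 0 < w by rewrite !mulr_gt0 // ltr_wpDl.
(* The bounds serve, in order, continuity of [tilt] at both ends, closeness of the slope to [al],
   the loss from the factor [1 - t], and [t < 1]. *)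
pose t := Num.min (Num.min d1 d2 / 2) (Num.min (eps / w) (Num.min eps (1 / 2))).
have m12 : 0 < Num.min d1 d2 by rewrite lt_min d10.
have t0 : 0 < t by rewrite lt_min (divr_gt0 m12) //= lt_min (divr_gt0 eps0 w0) /= lt_min eps0 /= divr_gt0.
have td : t < Num.min d1 d2.
  rewrite gt_min; apply/orP; left.
  by rewrite ltr_pdivrMr // mulr_natr mulr2n ltrDl.
have tw : t * w <= eps by rewrite -ler_pdivlMr // /t ge_min ge_min lexx orbT.
have te : t <= eps by rewrite /t ge_min ge_min ge_min lexx !orbT.
have t1 : t <= 1 / 2 by rewrite /t ge_min ge_min ge_min lexx !orbT.
have tlt1 : 0 < 1 - t by clear -t1; lra.
have t01' : 0 < t <= 1 by rewrite t0 -subr_ge0 ltW.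
have t01 : 0 <= t <= 1 by rewrite ltW // -subr_ge0 ltW.
have tn : `|t - 0| = t by rewrite subr0 gtr0_norm.
move: td; rewrite lt_min => /andP [td1 td2].
have := H1 t t01; rewrite tn -/(xt t) -/(xt 0) xt0 => /(_ td1) {}H1.
have := H2 t t01; rewrite tn -/(xt' t) -/(xt' 0) xt0' => /(_ td2) {}H2.
have rt := room_segment (cvX Yy0) t01' Ss rz.
have rt' := room_segment (cvX Yy0) t01' Ss' rz.
have segE s : (1 - t) *: s + t *: z = s + t *: (z - s).
  by rewrite scalerBl scale1r scalerBr -addrA [- _ + _]addrC.
rewrite segE in rt; rewrite segE in rt'.
have tr0 : 0 < t * r by rewrite mulr_gt0.
have St := room_mem (ltW tr0) rt; have [Xt qt] := xexpP St.
rewrite -/(xt t) in Xt qt.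
have sl_t : `|slope y0 y1 (xt t) e - al| <= eps.
  apply: (le_trans (HC3 _ Xt)); apply: le_trans tw.
  rewrite -{1}[x]xt0 /w mulrCA ler_wpM2l ?(ltW C30) //.
  have := HC2 y0 _ _ Yy0 Ss St; rewrite xexpK // xt0 -/(xt t).
  move=> /le_trans; apply; rewrite mulrCA ler_wpM2l ?(ltW C20) //.
  rewrite [q x y0 + _]addrC addrK normrZ gtr0_norm // ler_wpM2l ?(ltW t0) //.
  by rewrite lerDl.
have /ler_normlP [sl1 sl2] := sl_t.
have qtE : q (xt t) y0 + (1 - t) *: e = q x' y0 + t *: (z - q x' y0).
  rewrite qt /e -!segE -addrA [t *: z + _]addrC addrA -scalerDr.
  by rewrite [q x y0 + _]addrC subrK.
have := Hk (xt t) y0 y1 m M (t * r) ((1 - t) *: e) Xt Yy0 Yy1 dM tr0.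
rewrite qtE qt => /(_ rt rt'); rewrite slopeZ -/(xt' t).
have slp : 0 < (1 - t) * slope y0 y1 (xt t) e.
  by rewrite (mulr_gt0 tlt1) //; clear -sl1 epsal al0; lra.
move=> /(_ slp) low.
move: H1 H2; rewrite !ltr_norml => /andP [h1 h1'] /andP [h2 h2'].
have : k * ((1 - t) * (al - eps)) <= k * ((1 - t) * slope y0 y1 (xt t) e).
  by rewrite (ler_pM2l k0) (ler_pM2l tlt1); clear -sl1; lra.
have : k * (al - (1 + al) * eps) <= k * ((1 - t) * (al - eps)).
  rewrite ler_pM2l //.
  have := mulr_ge0 (ltW t0) (ltW eps0).
  have : t * al <= eps * al by rewrite ler_wpM2r // ltW.
  by clear; lra.
move: epsB; rewrite /B.
by lra.
Qed.

Lemma quantitative_quasi_convexity : exists2 M : R, 1 <= M &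
  forall x x0 y0 y1 t, X x -> X x0 -> Y y0 -> Y y1 -> 0 <= t <= 1 ->
  let f t := let yt := yexp x0 (p x0 y0 + t *: (p x0 y1 - p x0 y0)) in
    - c x yt + c x0 yt in
  f t - f 0 <= M * t * Num.max (f 1 - f 0) 0.
Proof.
have [k k0 Hk] := tilt_lower_bound.
(* The summand 2 handles [t >= 1 / 2], and [2 / k] handles [t < 1 / 2]. *)
exists (2 + 2 / k); first by rewrite -[leLHS]addr0 lerD ?ler1n // ltW // divr_gt0.
move=> x x0 y0 y1 t Xx Xx0 Yy0 Yy1 t01.
have /andP [t0 t1] := t01.
pose yt t := yexp x0 (p x0 y0 + t *: (p x0 y1 - p x0 y0)).
pose f t := - c x (yt t) + c x0 (yt t).
change (f t - f 0 <= (2 + 2 / k) * t * Num.max (f 1 - f 0) 0).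
have fE u : f u = - c x (yt u) + c x0 (yt u) by [].
have yt0 : yt 0 = y0 by rewrite /yt scale0r addr0 yexpK.
have yt1 : yt 1 = y1 by rewrite /yt scale1r addrC subrK yexpK.
have k20 : 0 < 2 / k by rewrite divr_gt0.
have M0 : 0 < 2 + 2 / k by rewrite addr_gt0.
have [ft0|ft0] := lerP (f t - f 0) 0.
  by rewrite (le_trans ft0) // !mulr_ge0 ?(ltW M0) // le_max lexx orbT.
have lt1 : f t <= f 1.
  have := loeper Xx Xx0 Yy0 Yy1 t01; rewrite /= -/(f t) le_max.
  rewrite [f 1]fE yt1 => /orP [] // h.
  by move: ft0; rewrite [f 0]fE yt0 subr_gt0 ltNge h.
have max1 : f 1 - f 0 <= Num.max (f 1 - f 0) 0 by rewrite le_max lexx.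
have f10 : 0 < f 1 - f 0 by apply: lt_le_trans ft0 _; rewrite lerB.
apply: (@le_trans _ _ ((2 + 2 / k) * t * (f 1 - f 0))); last first.
  by rewrite ler_wpM2l // mulr_ge0 // ltW.
have [t2|t2] := lerP (1 / 2) t.
  apply: (@le_trans _ _ (f 1 - f 0)); first by rewrite lerB.
  rewrite -[leLHS]mul1r ler_wpM2r ?(ltW f10) //.
  have := mulr_ge0 (ltW k20) t0; lra.
have tp : 0 < t.
  rewrite lt_def t0 andbT; apply/eqP => tE.
  by move: ft0; rewrite tE subrr ltxx.
pose df u := dotmx ((p x0 y1 - p x0 y0) *m (invmx (A x0 (yt u)))^T)
  (q x (yt u) - q x0 (yt u)).
have dfP u : 0 <= u <= 1 -> unit_deriv (V := R^o) f u (df u).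
  move=> u01; have [Yu pu du] := yexp_curve Xx0 Yy0 Yy1 u01.
  rewrite -/(yt u) in Yu pu du.
  have := unit_derivD (unit_derivZ (-1) (unit_deriv_dotmx (c_y Xx Yu) du))
    (unit_deriv_dotmx (c_y Xx0 Yu) du).
  rewrite scaleN1r !dotmxNl opprK -dotmxBl dotmxC -/(df u).
  by congr unit_deriv; apply/funext => v; rewrite fE /= scaleN1r.
(* [tilt_lower_bound] for the remaining piece from [yt u] to [y1], whose direction is [1 - u] times
   the original one; hence the factor [1 - u]. *)
have low u : 0 <= u < 1 -> 0 < df u -> k * (1 - u) * df u <= f 1 - f u.
  move=> /andP [u0 u1] dfu.
  have u01 : 0 <= u <= 1 by rewrite u0 ltW.
  have [Yu pu _] := yexp_curve Xx0 Yy0 Yy1 u01; rewrite -/(yt u) in Yu pu.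
  have sE : slope (yt u) y1 x0 (q x (yt u) - q x0 (yt u)) = (1 - u) * df u.
    rewrite slopeE pu /df -dotmxZl scalemxAl; congr (dotmx (_ *m _) _).
    by rewrite scalerBl scale1r opprD addrA.
  have := Hk x0 x (yt u) y1 Xx0 Xx Yu Yy1; rewrite sE mulrA => /(_ _).
  rewrite mulr_gt0 ?subr_gt0 // => /(_ isT).
  by rewrite /tilt !fE yt1 => /le_trans; apply; lra.
(* MVT after the last time before [t] at which [f <= f 0] *)
pose Z := [set u : R | 0 <= u <= t /\ f u <= f 0].
have Z0 : Z 0 by split => //; rewrite lexx.
have Zub : has_ubound Z by exists t => u [/andP []].
set s := sup Z.
have s0 : 0 <= s by exact: ub_le_sup.
have st : s <= t by apply: ge_sup; [exists 0 | move=> u [/andP []]].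
have s01 : 0 <= s <= 1 by rewrite s0 (le_trans st).
have fs : f s <= f 0.
  apply/ler_addgt0Pr => e e0.
  have [d d0 Hd] := unit_deriv_cont (dfP s s01) e0.
  have [u [/andP [u0 ut] fu] su] := sup_adherent d0 (conj (ex_intro _ 0 Z0) Zub).
  have us : u <= s by apply: ub_le_sup => //; split => //; rewrite u0.
  have := Hd u; rewrite u0 (le_trans ut) // => /(_ isT).
  rewrite distrC ger0_norm ?subr_ge0 // => /(_ _).
  have -> : s - u < d by rewrite -/s in su; lra.
  by move=> /(_ isT) /ltr_normlP [+ _]; lra.
have slt : s < t.
  by rewrite lt_neqAle st andbT; apply/eqP => sE; move: fs; rewrite sE leNgt -subr_gt0 ft0.
have [u /andP [su ut] uE] := unit_mvt dfP s0 slt t1.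
(* Being beyond the supremum, [u] is outside [Z]; so [f 1 - f u] stays below [f 1 - f 0]. *)
have fu : f 0 < f u.
  rewrite ltNge; apply/negP => fu0.
  suff : u <= s by rewrite leNgt su.
  by apply: ub_le_sup => //; split => //; apply/andP; split; lra.
have ts : 0 < t - s by rewrite subr_gt0.
have dfu : 0 < df u.
  by rewrite -(pmulr_lgt0 _ ts) -uE; lra.
have dft : f t - f 0 <= df u * t.
  have : f t - f 0 <= df u * (t - s) by rewrite -uE; lra.
  by have := mulr_ge0 (ltW dfu) s0; lra.
have u01' : 0 <= u < 1 by apply/andP; split; lra.
have := low u u01' dfu => lowu.
have kd : k * df u / 2 <= f 1 - f 0.
  have : k * df u * (1 / 2) <= k * df u * (1 - u).
    by rewrite ler_wpM2l ?mulr_ge0 ?(ltW k0) ?(ltW dfu) //; lra.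
  by lra.
have : df u <= 2 / k * (f 1 - f 0).
  rewrite mulrAC ler_pdivlMr //; lra.
move=> /(ler_wpM2r t0).
have := mulr_ge0 t0 (ltW f10); lra.
Qed.

End Cost.

(** * From partial derivatives of the cost to linear approximations *)

Section Bridge.
Context {R : realType} {n : nat}.
Local Notation V := 'rV[R]_n.

Lemma approx_linN {W : normedModType R} (f : V -> W) x (L : V -> W) :
  approx_lin f x L -> approx_lin (fun y => - f y) x (fun h => - L h).
Proof.
move=> fL e e0; have [d d0 H] := fL e e0; exists d => // y yd.
by rewrite -!opprD normrN H.
Qed.

Lemma diff_row_sum {W : normedModType R} (f : V -> W) x h : differentiable f x ->
  'd f x h = \sum_j h 0 j *: 'D_(ebase R j) f x.
Proof.
move=> df; rewrite {1}[h]row_sum_delta linear_sum; apply: eq_bigr => j _.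
by rewrite linearZ deriveE.
Qed.

Lemma diff_mulmx (f : V -> V) x h : differentiable f x ->
  'd f x h = h *m (\matrix_(i, j) 'D_(ebase R j) (fun y => f y 0 i) x)^T.
Proof.
move=> df; rewrite diff_row_sum //; apply/rowP => i.
rewrite summxE mxE; apply: eq_bigr => j _.
by rewrite derive_mx ?mxE //; exact: diff_derivable.
Qed.

(** The sign matches [p] and [q], which are opposites of gradients; the Jacobian is transposed
    because it acts on row vectors from the right. *)
Lemma approx_lin_mulmx (f : V -> V) x (J : 'M[R]_n) : differentiable f x ->
  J = (\matrix_(i, j) 'D_(ebase R j) (fun y => f y 0 i) x)^T ->
  approx_lin (fun y => - f y) x (fun h => h *m - J).
Proof.
move=> df JE; have := approx_linN (differentiable_approx df).
by congr approx_lin; apply/funext => h; rewrite diff_mulmx // mulmxN JE.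
Qed.

Lemma approx_lin_dotmx (f : V -> R) x :
  differentiable (f : V -> R^o) x ->
  approx_lin (W := R^o) f x (dotmx (\row_i 'D_(ebase R i) f x)).
Proof.
move=> df; have := differentiable_approx df.
congr approx_lin; apply/funext => h; rewrite diff_row_sum // dotmxE.
by apply: eq_bigr => i _; rewrite mxE mulrC.
Qed.

End Bridge.

Unset Implicit Arguments.

Theorem mainTheorem1 (R : realType) (n : nat)
  (X Y : set 'rV[R]_n) (c : 'rV[R]_n -> 'rV[R]_n -> R) :
  compact X -> compact Y ->
  (* twice differentiable: first partials and mixed second partials exist *)
  (forall x y, X x -> Y y ->
     [/\ differentiable (fun x' => c x' y) x,
         differentiable (fun y' => c x y') y,
         differentiable (fun y' => Dx c x y') y
       & differentiable (fun x' => Dy c x' y) x]) ->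
  (forall x y, X x -> Y y -> (D2xy c x y)^T = D2yx c x y) ->
  (* Twisted *)
  (forall x, X x -> {in Y &, injective (fun y => - Dx c x y)}) ->
  (* Twisted* *)
  (forall y, Y y -> {in X &, injective (fun x => - Dy c x y)}) ->
  (* Non-degenerate *)
  (forall x y, X x -> Y y -> D2xy c x y \in unitmx) ->
  (* Lip hessian *)
  (exists L : R, forall x x' y y', X x -> X x' -> Y y -> Y y' ->
     `|D2xy c x y - D2xy c x' y'| <= L * (`|x - x'| + `|y - y'|)) ->
  (* cDomConv *)
  (forall x, X x -> convex_set_of (Ystar c Y x)) ->
  (* cDomConv* *)
  (forall y, Y y -> convex_set_of (Xstar c X y)) ->
  Loeper c X Y -> QQconv c X Y.
Proof.
move=> cX cY dc sym tw twS nd [L lip] cvY cvX loe.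
pose p x y := - Dx c x y; pose q x y := - Dy c x y.
pose A x y := - D2xy c x y.
have p_inj x y y' : X x -> Y y -> Y y' -> p x y = p x y' -> y = y'.
  by move=> Xx Yy Yy' E; apply: (tw x Xx) => //; exact: mem_set.
have q_inj y x x' : Y y -> X x -> X x' -> q x y = q x' y -> x = x'.
  by move=> Yy Xx Xx' E; apply: (twS y Yy) => //; exact: mem_set.
have cexpK x y : X x -> Y y -> cexp c Y x (p x y) = y.
  by move=> Xx Yy; apply: (@inv_onK R n Y (p x)) => // u v; exact: p_inj.
have segE x0 y0 y1 (t : R) : (1 - t) *: p x0 y0 + t *: p x0 y1 =
    p x0 y0 + t *: (p x0 y1 - p x0 y0).
  by rewrite scalerBl scale1r scalerBr -!addrA; congr (_ + _); rewrite addrC.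
have ftE x x0 y0 y1 t : ft c Y x0 (p x0 y0) (p x0 y1) t x =
    let yt := inv_on Y (p x0) (p x0 y0 + t *: (p x0 y1 - p x0 y0)) in
    - c x yt + c x0 yt.
  by rewrite /ft segE.
(* The given [L] may be negative; [|L|] is again a Lipschitz constant. *)
have [||||||||||||||M M1 HM] := @quantitative_quasi_convexity R n X Y c p q A `|L|.
- exact: cX.
- exact: cY.
- move=> x y Xx Yy; have [d1 _ _ _] := dc x y Xx Yy.
  by rewrite /p opprK; exact: approx_lin_dotmx.
- move=> x y Xx Yy; have [_ d2 _ _] := dc x y Xx Yy.
  by rewrite /q opprK; exact: approx_lin_dotmx.
- move=> x y Xx Yy; have [_ _ d3 _] := dc x y Xx Yy.
  by rewrite /A linearN; exact: approx_lin_mulmx.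
- move=> x y Xx Yy; have [_ _ _ d4] := dc x y Xx Yy.
  (* Symmetry of the mixed Hessians lets the same [A] describe the derivative of [q] in [x]. *)
  have JE : D2xy c x y = (D2yx c x y)^T by rewrite -(sym x y Xx Yy) trmxK.
  exact: (@approx_lin_mulmx R n (fun x' => Dy c x' y) x (D2xy c x y) d4 JE).
- by move=> x y Xx Yy; rewrite /A -scaleN1r unitmxZ ?unitrN1 // nd.
- exact: p_inj.
- exact: q_inj.
- exact: normr_ge0.
- move=> x x' y y' Xx Xx' Yy Yy'.
  rewrite /A -opprD normrN (le_trans (lip _ _ _ _ Xx Xx' Yy Yy')) //.
  by rewrite ler_wpM2r ?ler_norm // addr_ge0.
- exact: cvY.
- exact: cvX.
- move=> x x0 y0 y1 t Xx Xx0 Yy0 Yy1 t01.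
  have := loe x x0 Xx Xx0 (p x0 y0) (p x0 y1).
  move=> /(_ (ex_intro2 _ _ y0 Yy0 erefl) (ex_intro2 _ _ y1 Yy1 erefl) t t01).
  rewrite ftE; congr (_ <= Num.max _ _).
    by rewrite /ft subrr scale0r add0r scale1r cexpK.
  by rewrite /ft subr0 scale0r addr0 scale1r cexpK.
- exists M; split => // x x0 Xx Xx0 _ _ [y0 Yy0 <-] [y1 Yy1 <-] t t01.
  by rewrite !ftE; exact: HM.
Qed.
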